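(* Let $0=D_m\subset\dots\subset D_0=D$ be a Jordan-Hölder sequence for the $\varphi$-module $D$ over $K$ (each $D_i$ is a sub-$\varphi$-module and each $D_i/D_{i+1}$ is a simple $\varphi$-module). Denote by $\overline{\varphi_i}$ the map induced by $\varphi$ on $D_i/D_{i+1}$ for $0\le i\le m-1$. Let $x\in D$. Then $$\chi_{\varphi,x}=\pi_{m-1}\cdots\pi_0,$$ where for all $0\le i\le m-1$, $\pi_i=\chi_{\overline{\varphi_i},y_i}$ for some $y_i\in D_i/D_{i+1}$ (in particular each polynomial $\pi_i$ is irreducible in $K[X,\sigma]$).
   Context: $K$ is a field of characteristic $p>0$, $q=p^a$ with $a\ge1$, $\mathbb{F}_q\subset K$, $\sigma(y)=y^q$. $K[X,\sigma]$ is the skew polynomial ring with $X\cdot c=\sigma(c)\cdot X$ for $c\in K$. A $\varphi$-module over $K$ is a finite-dimensional $K$-vector space $D$ with an additive map $\varphi:D\to D$ such that $\varphi(\lambda y)=\sigma(\lambda)\varphi(y)$. It is simple if it has no nontrivial subspace stable under $\varphi$. Semi-characteristic polynomial: let $d\ge1$, let $G=(a_{ij})$ be a $d\times d$ matrix of indeterminates and $\xi=(x_1,\dots,x_d)^T$ a vector of indeterminates; put $\xi_0=\xi$ and $\xi_{i+1}=G\,\sigma(\xi_i)$, $\sigma$ raising every coordinate to the $q$-th power. There are unique $P_0,\dots,P_{d-1}\in K[x_1,\dots,x_d][(a_{ij})]$ with $\xi_d=\sum_{i=0}^{d-1}P_i\xi_i$. For a $\varphi$-module $D$ of dimension $d$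 with a basis $\mathcal B=(b_1,\dots,b_d)$, and $x\in D$, the semi-characteristic polynomial $\chi_{\varphi,x}=\chi_{\varphi,x,\mathcal B}$ is $X^d-\sum_{i=0}^{d-1}p_iX^i\in K[X,\sigma]$, where $p_i$ is the evaluation of $P_i$ at the matrix of $\varphi$ in $\mathcal B$ (column $j$ = coordinates of $\varphi(b_j)$) and at the coordinates of $x$ in $\mathcal B$. It satisfies $\chi_{\varphi,x}(\varphi)(x)=0$; here $(\sum c_iX^i)(\varphi)=\sum c_i\varphi^i$.
   Formalization: Irreducibility of π_i is claimed only if y_i ≠ 0, or dim D_i/D_{i+1} = 1, or x generates D; as stated it fails, e.g. for D simple of dimension d ≥ 2 and x = 0, where π_0 = X^d is reducible. *)

(* Defs.v *)
From HB Require Import structures.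
From Stdlib Require Import ClassicalEpsilon.
From mathcomp Require Import all_boot all_order all_algebra.
From mathcomp Require Import generic_quotient ring_quotient.
From mathcomp Require Import mpoly.

Set Implicit Arguments.
Unset Strict Implicit.
Unset Printing Implicit Defensive.

Import GRing.Theory.
Local Open Scope ring_scope.

Definition frobq (K : fieldType) (p : nat) of p \in [pchar K] :=
  fun (a : nat) (y : K) => y ^+ (p ^ a).

Section PowerFrobenius.
Variables (K : fieldType) (p : nat) (charK : p \in [pchar K]) (a : nat).

Fact frobq_iter : frobq charK a =1 iter a (pFrobenius_aut charK).
Proof.
rewrite /frobq; elim: a => [|n IHn] y; first by rewrite expr1.
by rewrite expnSr exprM IHn.
Qed.

Fact frobq_nmod_morphism : nmod_morphism (frobq charK a).
Proof.
split=> [|x y]; rewrite !frobq_iter.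
  by elim: a => //= n ->; rewrite rmorph0.
by elim: a => //= n ->; rewrite rmorphD.
Qed.

Fact frobq_monoid_morphism : monoid_morphism (frobq charK a).
Proof. by split=> [|x y]; rewrite /frobq ?expr1n ?exprMn. Qed.

HB.instance Definition _ := GRing.isNmodMorphism.Build K K (frobq charK a)
  frobq_nmod_morphism.
HB.instance Definition _ := GRing.isMonoidMorphism.Build K K (frobq charK a)
  frobq_monoid_morphism.
End PowerFrobenius.

(* The skew polynomial ring K[X, sigma]: the carrier is {poly K}, p`_i being   *)
(* the coefficient written to the left of X^i, and                            *)
(*   (\sum_i a_i X^i) (\sum_j b_j X^j) = \sum_(i, j) a_i sigma^i(b_j) X^(i+j). *)
Section SkewPoly.
Variables (K : fieldType) (sigma : {rmorphism K -> K}).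

Definition skewpoly of {rmorphism K -> K} : Type := {poly K}.
Local Notation S := (skewpoly sigma).

HB.instance Definition _ := GRing.Zmodule.copy S {poly K}.

Definition sigman (i : nat) : K -> K := iter i sigma.

Fact sigman_nmod_morphism i : nmod_morphism (sigman i).
Proof.
by split=> [|x y]; elim: i => //= i ->; rewrite ?rmorph0 ?rmorphD.
Qed.
Fact sigman_monoid_morphism i : monoid_morphism (sigman i).
Proof.
by split=> [|x y]; elim: i => //= i ->; rewrite ?rmorph1 ?rmorphM.
Qed.
HB.instance Definition _ i := GRing.isNmodMorphism.Build K K (sigman i)
  (sigman_nmod_morphism i).
HB.instance Definition _ i := GRing.isMonoidMorphism.Build K K (sigman i)
  (sigman_monoid_morphism i).

Definition skew_mul (u v : S) : S :=
  \sum_(i < size (u : {poly K}))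
    (u : {poly K})`_i *: (map_poly (sigman i) v * 'X^i) : {poly K}.

Definition skewC (c : K) : S := c%:P.
Definition skewX : S := 'X.

Fact skew_mulE n (u v : S) : (size (u : {poly K}) <= n)%N ->
  skew_mul u v = \sum_(i < n)
    (u : {poly K})`_i *: (map_poly (sigman i) v * 'X^i) :> {poly K}.
Proof.
move=> le_un; rewrite /skew_mul.
rewrite (big_ord_widen n
  (fun i => (u : {poly K})`_i *: (map_poly (sigman i) v * 'X^i))) //.
rewrite big_mkcond /=; apply: eq_bigr => i _; case: ltnP => // le_ui.
by rewrite nth_default // scale0r.
Qed.

Fact skew_mulDl : left_distributive skew_mul +%R.
Proof.
move=> u v w; pose n := maxn (size (u : {poly K})) (size (v : {poly K})).
rewrite (@skew_mulE n (u + v)) ?size_polyD //.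
rewrite (@skew_mulE n u) ?leq_maxl // (@skew_mulE n v) ?leq_maxr //.
rewrite -big_split; apply: eq_bigr => i _ /=.
by rewrite coefD scalerDl.
Qed.

Fact skew_mulDr : right_distributive skew_mul +%R.
Proof.
move=> u v w; rewrite /skew_mul -big_split; apply: eq_bigr => i _ /=.
by rewrite rmorphD mulrDl scalerDr.
Qed.

Fact skew_mul0l v : skew_mul 0 v = 0.
Proof. by rewrite /skew_mul size_poly0 big_ord0. Qed.

Fact skew_mul0r u : skew_mul u 0 = 0.
Proof.
by rewrite /skew_mul big1 // => i _; rewrite rmorph0 mul0r scaler0.
Qed.

Local Notation mono c i := (c *: 'X^i : {poly K}).

Fact skew_mul_mono (c d : K) i j :
  skew_mul (mono c i) (mono d j) = mono (c * sigman i d) (i + j).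
Proof.
rewrite (@skew_mulE i.+1); last by rewrite (leq_trans (size_scale_leq _ _)) ?size_polyXn.
rewrite big_ord_recr big1 /= => [|k _]; last first.
  by rewrite coefZ coefXn ltn_eqF // mulr0 scale0r.
rewrite add0r coefZ coefXn eqxx mulr1 map_polyZ map_polyXn.
by rewrite -scalerAl scalerA -exprD addnC.
Qed.

Fact skew_polyE (u : S) :
  u = \sum_(i < size (u : {poly K})) (mono (u : {poly K})`_i i : S).
Proof. by rewrite -[LHS]coefK poly_def. Qed.

Fact skew_ind (P : S -> Prop) :
    P 0 -> (forall u v, P u -> P v -> P (u + v)) ->
  (forall c i, P (mono c i)) -> forall u, P u.
Proof. by move=> P0 PD PZ u; rewrite [u]skew_polyE; apply: big_ind. Qed.

Fact skew_mulA : associative skew_mul.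
Proof.
move=> u v w; elim/skew_ind: u => [|u1 u2 E1 E2|c i].
- by rewrite !skew_mul0l.
- by rewrite skew_mulDl E1 E2 -skew_mulDl -(skew_mulDl u1).
elim/skew_ind: v => [|v1 v2 E1 E2|d j].
- by rewrite skew_mul0r !skew_mul0l skew_mul0r.
- by rewrite skew_mulDl skew_mulDr E1 E2 -skew_mulDl -(skew_mulDr _ v1).
elim/skew_ind: w => [|w1 w2 E1 E2|e k].
- by rewrite !skew_mul0r.
- by rewrite [skew_mul (mono d j) _]skew_mulDr skew_mulDr E1 E2 -skew_mulDr.
rewrite !skew_mul_mono rmorphM mulrA addnA.
by congr ((_ * _) *: _); rewrite /sigman iterD.
Qed.

Fact skew_mul1l : left_id (1%:P : S) skew_mul.
Proof.
move=> v; rewrite (@skew_mulE 1) ?size_polyC ?oner_neq0 // big_ord1.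
by rewrite coefC scale1r mulr1 map_poly_id.
Qed.

Fact skew_mul1r : right_id (1%:P : S) skew_mul.
Proof.
move=> u; apply: etrans (esym (skew_polyE u)); apply: eq_bigr => i _.
by rewrite map_polyC [_ 1](rmorph1 (sigman i)) mul1r.
Qed.

Fact skew_oner_neq0 : (1%:P : S) != 0.
Proof. exact: oner_neq0. Qed.

HB.instance Definition _ := GRing.Zmodule_isNzRing.Build S
  skew_mulA skew_mul1l skew_mul1r skew_mulDl skew_mulDr skew_oner_neq0.

Lemma skewXC c : skewX * skewC c = skewC (sigma c) * skewX :> S.
Proof.
have eX : skewX = mono 1 1 by rewrite scale1r expr1.
have eC b : skewC b = mono b 0 by rewrite expr0 alg_polyC.
by rewrite eX !eC /GRing.mul /= !skew_mul_mono mul1r /= mulr1.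
Qed.

End SkewPoly.

Section Irreducible.
Variable R : nzRingType.
Definition invertible (u : R) := exists v, u * v = 1 /\ v * u = 1.
Definition irreducible_elt (u : R) :=
  [/\ u <> 0, ~ invertible u
    & forall v w : R, u = v * w -> invertible v \/ invertible w].
End Irreducible.

(* V / W, with the vector space structure on top of the library's quotient    *)
(* abelian group.                                                             *)
Section VectorQuotient.
Variables (K : fieldType) (V : vectType K) (W : {vspace V}).
Local Open Scope quotient_scope.

Definition vquot : Type := Quotient.quot (pred_of_vspace W).
HB.instance Definition _ := Choice.on vquot.
HB.instance Definition _ := EqQuotient.on vquot.
HB.instance Definition _ := GRing.Zmodule.on vquot.

Definition vqproj (v : V) : vquot := \pi_vquot v.

Lemma eq_vqproj u v : (vqproj u == vqproj v) = (u - v \in W).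
Proof. by rewrite /vqproj piE. Qed.

Lemma vqreprK (u : vquot) : vqproj (repr u) = u.
Proof. exact: reprK. Qed.

Lemma vqprojP (u : vquot) : exists v, u = vqproj v.
Proof. by exists (repr u); rewrite vqreprK. Qed.

Fact vqproj_is_zmod_morphism : zmod_morphism vqproj.
Proof. by move=> u v; rewrite /vqproj /= !piE. Qed.
HB.instance Definition _ := GRing.isZmodMorphism.Build V vquot vqproj
  vqproj_is_zmod_morphism.

Definition vqscale (c : K) (u : vquot) : vquot := vqproj (c *: repr u).

Fact vqprojZ c v : vqproj (c *: v) = vqscale c (vqproj v).
Proof.
apply/eqP; rewrite /vqscale eq_vqproj -scalerBr rpredZ // -eq_vqproj.
by rewrite vqreprK.
Qed.

Fact vqscaleA a b u : vqscale a (vqscale b u) = vqscale (a * b) u.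
Proof. by have [v ->] := vqprojP u; rewrite -!vqprojZ scalerA. Qed.

Fact vqscale1 : left_id 1 vqscale.
Proof. by move=> u; have [v ->] := vqprojP u; rewrite -vqprojZ scale1r. Qed.

Fact vqscaleDr : right_distributive vqscale +%R.
Proof.
move=> a u1 u2; have [v1 ->] := vqprojP u1; have [v2 ->] := vqprojP u2.
by rewrite -raddfD -!vqprojZ -raddfD scalerDr.
Qed.

Fact vqscaleDl u : {morph vqscale^~ u : a b / a + b}.
Proof.
move=> a b; have [v ->] := vqprojP u.
by rewrite -!vqprojZ -raddfD scalerDl.
Qed.

HB.instance Definition _ := GRing.Zmodule_isLmodule.Build K vquot
  vqscaleA vqscale1 vqscaleDr vqscaleDl.

Fact vqproj_is_scalable : scalable vqproj.
Proof. by move=> c v; rewrite vqprojZ. Qed.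
HB.instance Definition _ := GRing.isScalable.Build K V vquot _ vqproj
  vqproj_is_scalable.

(* Coordinates on V / W are read on the complement W^C of W in V. *)
Fact vquot_vect_iso : Vector.axiom (\dim W^C) vquot.
Proof.
pose b := vbasis W^C; pose g v := v - projv W v.
pose f (u : vquot) := \row_i coord b i (g (repr u)).
have gW v : v \in W -> g v = 0 by move=> Wv; rewrite /g projv_id // subrr.
have gP c v w : g (c *: v + w) = c *: g v + g w.
  by rewrite /g linearP opprD addrACA scalerBr.
have fE v : f (vqproj v) = \row_i coord b i (g v).
  have: vqproj (repr (vqproj v)) == vqproj v by rewrite vqreprK.
  rewrite eq_vqproj => /gW Eg; rewrite /f -[repr _](subrK v).
  by apply/rowP=> i; rewrite !mxE -[_ - _]scale1r gP Eg scaler0 add0r.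
exists f.
  move=> c u1 u2; have [v1 ->] := vqprojP u1; have [v2 ->] := vqprojP u2.
  by rewrite -linearP !fE; apply/rowP=> i; rewrite !mxE gP linearP.
exists (fun r : 'rV_(\dim W^C) => vqproj (\sum_i r 0 i *: b`_i)).
  move=> u; have [v ->] := vqprojP u; rewrite fE.
  under eq_bigr do rewrite mxE.
  rewrite -coord_vbasis ?memv_projC //; apply/eqP.
  by rewrite eq_vqproj /g addrAC subrr add0r rpredN memv_proj.
move=> r; rewrite fE; apply/rowP=> i; rewrite mxE.
set s := \sum_i _; have Ws : s \in (W^C)%VS.
  by apply: rpred_sum => j _; rewrite rpredZ ?vbasis_mem ?memt_nth.
have ->: g s = s.
  have: s \in lker (projv W) by rewrite lker_proj.
  by rewrite memv_ker /g => /eqP->; rewrite subr0.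
by rewrite coord_sum_free ?(basis_free (vbasisP _)).
Qed.

HB.instance Definition _ := Lmodule_hasFinDim.Build K vquot vquot_vect_iso.

End VectorQuotient.

Section PhiModule.
Variables (K : fieldType) (V : vectType K) (phi : V -> V).

Definition phi_stable (U : {vspace V}) := forall v, v \in U -> phi v \in U.

Definition phi_simple :=
  (0 < \dim {: V})%N /\
  forall U : {vspace V}, phi_stable U -> U = 0%VS \/ U = fullv.

(* The iterates phi^i v span V. *)
Definition phi_generator (v : V) :=
  forall U : {vspace V}, phi_stable U -> v \in U -> U = fullv.

End PhiModule.

Section Subquotient.
Variables (K : fieldType) (V : vectType K).
Implicit Types U W : {vspace V}.

(* U / W, for W a subspace of U. *)
Definition subquot U W : vectType K :=
  vquot (linfun (vsval : subvs_of U -> V) @^-1: W).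

Definition subquot_proj U W (v : subvs_of U) : subquot U W := vqproj _ v.

(* The map v mod W |-> phi v mod W on U / W.  It is computed on a chosen       *)
(* representative, and vsproj turns phi v into an element of subvs_of U; both  *)
(* are harmless when U and W are phi-stable, see subquot_mapE.                 *)
Definition subquot_map (phi : V -> V) U W (u : subquot U W) : subquot U W :=
  subquot_proj W (vsproj U (phi (vsval (repr (u : vquot _))))).

Arguments subquot_map phi U W u : clear implicits.

Lemma subquot_mapE (phi : {additive V -> V}) U W (v w : subvs_of U) :
    phi_stable phi U -> phi_stable phi W -> vsval w = phi (vsval v) ->
  subquot_map phi U W (subquot_proj W v) = subquot_proj W w.
Proof.
move=> Us Ws Ew; apply/eqP; rewrite eq_vqproj.
have /eqP := vqreprK (subquot_proj W v); rewrite eq_vqproj.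
move: (repr _) => v'.
rewrite -!memv_preim !lfunE !linearB /= => /Ws.
by rewrite raddfB vsprojK ?Us ?subvsP // Ew.
Qed.

Definition jordan_holder (phi : V -> V) (m : nat) (D_ : nat -> {vspace V}) :=
  [/\ D_ 0%N = fullv, D_ m = 0%VS,
      forall i, (i <= m)%N -> phi_stable phi (D_ i),
      forall i, (i < m)%N -> (D_ i.+1 <= D_ i)%VS
    & forall i, (i < m)%N -> phi_simple (subquot_map phi (D_ i) (D_ i.+1))].

End Subquotient.
Arguments subquot_map {K V} phi U W u.

Section GenericRelation.
Variables (K : fieldType) (q d : nat).
Local Notation A := {mpoly {mpoly K[d]}[d * d]}.

Definition generic_mx : 'M[A]_d := \matrix_(i, j) 'X_(mxvec_index i j).
Definition generic_vec : 'cV[A]_d := \col_i ('X_i)%:MP.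

Fixpoint generic_iter (i : nat) : 'cV[A]_d :=
  if i is j.+1 then generic_mx *m map_mx (fun f => f ^+ q) (generic_iter j)
  else generic_vec.

Definition generic_relation (P : 'I_d -> A) :=
  generic_iter d = \sum_(i < d) P i *: generic_iter i.

(* The family P_0, ..., P_(d-1) satisfying generic_relation: there is one, and *)
(* it is unique since xi_0, ..., xi_(d-1) are linearly independent.            *)
Definition semichar_generic : 'I_d -> A :=
  epsilon (inhabits (fun=> 0)) generic_relation.

Definition semichar_coef (G : 'M[K]_d) (x : 'cV[K]_d) (i : 'I_d) : K :=
  (semichar_generic i).@[fun k => (mxvec G 0 k)%:MP].@[fun k => x k 0].

End GenericRelation.

Section SemiCharacteristic.
Variables (K : fieldType) (p : nat) (charK : p \in [pchar K]) (a : nat).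
Variables (V : vectType K) (phi : V -> V) (d : nat) (B : d.-tuple V) (v : V).

Definition phi_mx : 'M[K]_d := \matrix_(i, j) coord B i (phi (tnth B j)).
Definition coord_vec : 'cV[K]_d := \col_i coord B i v.

Definition semichar : skewpoly (frobq charK a) :=
  skewX _ ^+ d
  - \sum_(i < d) skewC _ (semichar_coef (p ^ a) phi_mx coord_vec i) * skewX _ ^+ i.

End SemiCharacteristic.

(* Main.v *)
(* Existence of the generic coefficients.  Let X be the matrix with columns    *)
(* xi_0, ..., xi_(d-1); over the fraction field, Cramer's rule gives           *)
(* xi_d = \sum_i c_i xi_i.  Put M = T^(q^d) - \sum_i c_i T^(q^i) and let u be   *)
(* the row vector (T, T^q, ..., T^(q^(d-1))) X^-1.  Modulo M one has           *)
(* u xi_i = T^(q^i) for i <= d, hence u_j^q = \sum_k u_k a_kj, and T = u xi_0. *)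
(* So the span over the polynomial ring of the q^d monomials in the u_j with   *)
(* exponents < q is stable under multiplication by T; by Cayley-Hamilton the   *)
(* characteristic polynomial of this multiplication, which has polynomial      *)
(* coefficients, is divisible by M.  Both are monic of degree q^d, so they are *)
(* equal and the c_i are polynomials.                                          *)
(*                                                                             *)
(* Multiplicativity.  When the xi_i are independent the coefficients are the   *)
(* only solution of xi_d = \sum_i P_i xi_i, which yields independence of the   *)
(* basis and, in a basis adapted to a submodule W, the factorization           *)
(* chi_x = chi_(w, W) chi_(x mod W) with w = chi_(x mod W)(phi)(x) in W.  Any   *)
(* (G, x) over K is the value at t = 0 of a pair over K[t] whose value at t = 1 *)
(* is the cyclic shift with its first basis vector, which has independent      *)
(* iterates; so both identities hold for every (G, x).                         *)

From HB Require Import structures.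
From Stdlib Require Import ClassicalEpsilon.
Require Import Defs.
From mathcomp Require Import all_boot all_order all_algebra.
From mathcomp Require Import fraction zify mpoly.

Set Implicit Arguments.
Unset Strict Implicit.
Unset Printing Implicit Defensive.

Import GRing.Theory.
Local Open Scope ring_scope.

(** Everything rests on one factorization, [residueP]. Let $W \subset U$ be stable and $v \in U$.
    The operator $\chi_{v \bmod W}(\varphi)$ kills $v$ modulo $W$, so it sends $v$ to some $w \in
    W$, and $\chi_v = \chi_w \cdot \chi_{v \bmod W}$, the factors being taken on $W$ and on $U/W$.
    Applied along the filtration from $x_0 = x$, this produces $x_i \in D_i$; $y_i$ is the class of
    $x_i$, and the polynomial left over on $D_m = 0$ is 1.

    The factorization is proved on matrices ([gsemichar_block]). In a basis adapted to $W$ the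
    product is monic of the right degree and kills $v$. Such an annihilator is unique when the
    iterates of $v$ are independent, and a deformation over $K[t]$ reduces the general case to that
    one. The deformation makes sense because the generic coefficients are polynomials and not only
    rational functions ([krylov_relation_frac], [generic_relation_exists]). [semichar_basis] then
    allows arbitrary bases.

    For irreducibility ([semichar_irreducible]): in a simple module of dimension $d$ a nonzero
    vector is not killed by a nonzero operator of degree less than $d$ ([act_simple_neq0]), while a
    factorization of $\chi_y$ into two nonconstant factors would produce such an operator. If $x$
    generates $D$, each $x_i$ generates $D_i$ ([generates_residue]), so every $y_i$ is nonzero. *)

Definition powq (R : comNzRingType) (p : nat) of p \in [pchar R] :=
  fun (a : nat) (y : R) => y ^+ (p ^ a).

(** * Semilinear iteration *)

Section PowQ.
Variables (R : comNzRingType) (p : nat) (charR : p \in [pchar R]) (a : nat).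

Fact powq_nmod_morphism : nmod_morphism (powq charR a).
Proof.
have p_pr := pcharf_prime charR.
split=> [|x y]; rewrite /powq.
  by rewrite expr0n expn_eq0 (gtn_eqF (prime_gt0 p_pr)).
by rewrite exprDn_pchar // pnatX (pnatE _ p_pr) charR.
Qed.

Fact powq_monoid_morphism : monoid_morphism (powq charR a).
Proof. by split=> [|x y]; rewrite /powq ?expr1n ?exprMn. Qed.

HB.instance Definition _ := GRing.isNmodMorphism.Build R R (powq charR a)
  powq_nmod_morphism.
HB.instance Definition _ := GRing.isMonoidMorphism.Build R R (powq charR a)
  powq_monoid_morphism.
End PowQ.

Definition sfrob (R : comNzRingType) (q d : nat) (G : 'M[R]_d) (v : 'cV[R]_d) :=
  G *m map_mx (fun y => y ^+ q) v.

Definition siter (R : comNzRingType) (q d : nat) (G : 'M[R]_d) (x : 'cV[R]_d)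
  (i : nat) : 'cV[R]_d := iter i (sfrob q G) x.

Definition krylov (R : comNzRingType) (q d : nat) (G : 'M[R]_d) (x : 'cV[R]_d) :=
  \matrix_(i < d, j < d) siter q G x j i 0.

Lemma siterS (R : comNzRingType) q d (G : 'M[R]_d) x i :
  siter q G x i.+1 = sfrob q G (siter q G x i).
Proof. by []. Qed.

Lemma map_siter (R S : comNzRingType) (f : {rmorphism R -> S}) q d
    (G : 'M[R]_d) x i :
  map_mx f (siter q G x i) = siter q (map_mx f G) (map_mx f x) i.
Proof.
elim: i => [//|i IHi]; rewrite !siterS -IHi /sfrob map_mxM; congr (_ *m _).
by apply/matrixP=> k l; rewrite !mxE rmorphXn.
Qed.

Lemma map_krylov (R S : comNzRingType) (f : {rmorphism R -> S}) q d
    (G : 'M[R]_d) x :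
  map_mx f (krylov q G x) = krylov q (map_mx f G) (map_mx f x).
Proof. by apply/matrixP=> i j; rewrite !mxE -map_siter mxE. Qed.

Lemma krylov_mul (R : comNzRingType) q d (G : 'M[R]_d) x (c : 'cV[R]_d) :
  krylov q G x *m c = \sum_(i < d) c i 0 *: siter q G x i.
Proof.
apply/colP=> k; rewrite mxE summxE; apply: eq_bigr => i _.
by rewrite !mxE mulrC.
Qed.

Lemma prod_exp_divide (R : comNzRingType) (I : finType) (w : I -> R) m i q :
  (q <= m i)%N ->
  \prod_j w j ^+ m j = w i ^+ q * \prod_j w j ^+ (m j - q * (j == i)).
Proof.
move=> leqm; rewrite (bigD1 i) //= [in RHS](bigD1 i) //= mulrA eqxx muln1.
rewrite -exprD subnKC //; congr (_ * _).
by apply: eq_bigr => j /negPf->; rewrite muln0 subn0.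
Qed.

Lemma prod_exp_mul (R : comNzRingType) (I : finType) (w : I -> R) m i :
  w i * \prod_j w j ^+ m j = \prod_j w j ^+ (m j + (j == i)).
Proof.
under [RHS]eq_bigr do rewrite exprD.
rewrite big_split /= mulrC; congr (_ * _).
by rewrite (bigD1 i) //= eqxx big1 ?mulr1 // => j /negPf->.
Qed.

(** * Polynomiality of the generic coefficients *)

Section ModularSpan.
Variables (A : comNzRingType) (F : fieldType) (iota : {rmorphism A -> F}).
Variables (q d : nat) (G : 'M[A]_d) (M : {poly F}) (u : 'rV[{poly F}]_d).
Hypothesis (q_gt1 : (1 < q)%N).
Hypothesis uG : forall j,
  M %| u 0 j ^+ q - \sum_k (iota (G k j))%:P * u 0 k.

Local Notation E := {ffun 'I_d -> 'I_q}.
Definition bmon (e : E) : {poly F} := \prod_j u 0 j ^+ e j.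

(** The coefficients come from [A] and not from [F]: this is how denominators are kept under
    control. *)
Definition in_span (f : {poly F}) :=
  exists c : E -> A, M %| f - \sum_e (iota (c e))%:P * bmon e.

Lemma in_span_add f g : in_span f -> in_span g -> in_span (f + g).
Proof.
move=> [b Mb] [c Mc]; exists (fun e => b e + c e).
have ->: f + g - \sum_e (iota (b e + c e))%:P * bmon e =
  (f - \sum_e (iota (b e))%:P * bmon e) + (g - \sum_e (iota (c e))%:P * bmon e).
  rewrite addrACA -opprD -big_split /=; congr (_ - _).
  by apply: eq_bigr => e _; rewrite rmorphD polyCD mulrDl.
by rewrite dvdp_add.
Qed.

Lemma in_span_scale a f : in_span f -> in_span ((iota a)%:P * f).
Proof.
move=> [b Mb]; exists (fun e => a * b e).
have ->: (iota a)%:P * f - \sum_e (iota (a * b e))%:P * bmon e =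
  (iota a)%:P * (f - \sum_e (iota (b e))%:P * bmon e).
  rewrite mulrBr mulr_sumr; congr (_ - _).
  by apply: eq_bigr => e _; rewrite rmorphM polyCM mulrA.
by rewrite dvdp_mull.
Qed.

Lemma in_span_mod f g : M %| f - g -> in_span g -> in_span f.
Proof.
move=> Mfg [b Mb]; exists b; rewrite -[f](subrK g) -addrA.
by rewrite dvdp_add.
Qed.

Lemma in_span0 : in_span 0.
Proof.
exists (fun=> 0); rewrite big1 ?subr0 ?dvdp0 // => e _.
by rewrite rmorph0 mul0r.
Qed.

Lemma in_span_sum (I : finType) (f : I -> {poly F}) :
  (forall i, in_span (f i)) -> in_span (\sum_i f i).
Proof.
move=> fS; elim/big_ind: _ => //; [exact: in_span0 | exact: in_span_add].
Qed.

Lemma in_span_bmon e : in_span (bmon e).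
Proof.
exists (fun e' => (e' == e)%:R).
rewrite (bigD1 e) //= eqxx rmorph1 mul1r big1 ?addr0 ?subrr ?dvdp0 //.
by move=> e' /negPf->; rewrite rmorph0 mul0r.
Qed.

(** Induction on the total degree: when an exponent is at least [q], rewriting $u_j^q$ as $\sum_k
    G_{kj} u_k$ modulo [M] trades [q] factors for one, and [q > 1]. *)
Lemma in_span_mon (m : 'I_d -> nat) : in_span (\prod_j u 0 j ^+ m j).
Proof.
have [n] := ubnP (\sum_j m j); elim: n m => // n IHn m lemn.
have [/forallP ltmq|] := boolP [forall j, (m j < q)%N].
  have:= in_span_bmon [ffun j => Ordinal (ltmq j)]; rewrite /bmon.
  by under eq_bigr do rewrite ffunE.
rewrite negb_forall => /existsP[j0]; rewrite -leqNgt => leqm.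
pose r := \prod_j u 0 j ^+ (m j - q * (j == j0)).
have Em: \prod_j u 0 j ^+ m j = u 0 j0 ^+ q * r.
  exact: prod_exp_divide.
apply: (@in_span_mod _ (\sum_k (iota (G k j0))%:P * (u 0 k * r))).
  have ->: \sum_k (iota (G k j0))%:P * (u 0 k * r) =
           (\sum_k (iota (G k j0))%:P * u 0 k) * r.
    by rewrite mulr_suml; apply: eq_bigr => k _; exact: mulrA.
  by rewrite Em -mulrBl dvdp_mulr.
apply: in_span_sum => k; apply: in_span_scale.
have ->: u 0 k * r = \prod_j u 0 j ^+ (m j - q * (j == j0) + (j == k)).
  exact: prod_exp_mul.
apply: IHn; rewrite -ltnS; apply: leq_trans lemn; rewrite !ltnS big_split /=.
have ->: (\sum_j (j == k) = 1)%N.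
  by rewrite (bigD1 k) //= eqxx big1 ?addn0 // => j /negPf->.
rewrite [X in (_ < X)%N](bigD1 j0) //= (bigD1 j0) //= eqxx muln1 addn1.
have ->: (\sum_(j | j != j0) (m j - q * (j == j0)) = \sum_(j | j != j0) m j)%N.
  by apply: eq_bigr => j /negPf->; rewrite muln0 subn0.
by set S := (\sum_(j | j != j0) m j)%N; lia.
Qed.

(** An integrality argument: multiplication by ['X] on the $q^d$ monomials has a matrix [r] over
    [A], and [M] must be the image of its characteristic polynomial. *)
Lemma monic_descent (z : 'I_d -> A) :
    M \is monic -> size M = (q ^ d).+1 ->
    'X = \sum_k (iota (z k))%:P * u 0 k ->
  exists f, M = map_poly iota f.
Proof.
move=> monM szM Xz.
have spanX e : in_span ('X * bmon e).
  have ->: 'X * bmon e = \sum_k (iota (z k))%:P * (u 0 k * bmon e).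
    by rewrite Xz mulr_suml; apply: eq_bigr => k _; rewrite mulrA.
  apply: in_span_sum => k; apply: in_span_scale.
  by rewrite prod_exp_mul; apply: in_span_mon.
have [c Mc] := fin_all_exists spanX.
pose r := \matrix_(i < #|E|, j < #|E|) c (enum_val i) (enum_val j).
pose w : 'cV[{poly F}]_#|E| := \col_i bmon (enum_val i).
have Mw i : M %| (char_poly_mx (map_mx iota r) *m w) i 0.
  have:= Mc (enum_val i); set f := _ - _; set g := _ i 0; suff -> : g = f by [].
  rewrite /g /f /char_poly_mx mulmxBl mul_scalar_mx !mxE; congr (_ - _).
  rewrite [RHS](reindex (@enum_val E xpredT)) /=; last first.
    by apply: onW_bij; apply: enum_val_bij.
  by apply: eq_bigr => j _; rewrite !mxE.
have q_gt0 : (0 < q)%N by apply: ltnW.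
(* The monomial with all exponents zero is 1, so its row in the adjugate identity isolates the
   determinant. *)
pose e0 : E := [ffun => Ordinal q_gt0].
have : M %| char_poly (map_mx iota r).
  rewrite /char_poly; set C := char_poly_mx _.
  have adjC : \adj C *m (C *m w) = \det C *: w.
    by rewrite mulmxA mul_adj_mx mul_scalar_mx.
  have:= congr1 (fun m : 'cV_ _ => m (enum_rank e0) 0) adjC.
  rewrite !mxE enum_rankK /bmon.
  under [in RHS]eq_bigr do rewrite ffunE expr0.
  rewrite big1_eq mulr1 => <-.
  by apply: (big_ind (fun f => M %| f)) => [|f g|i _];
    [rewrite dvdp0 | apply: dvdp_add | rewrite dvdp_mull].
have cardE : #|E| = (q ^ d)%N by rewrite card_ffun !card_ord.
move=> /dvdp_size_eqp; rewrite size_char_poly szM -{1}cardE eqxx => /esym.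
 rewrite eqp_monic ?char_poly_monic // => /eqP->.
by exists (char_poly r); rewrite ?map_char_poly.
Qed.

End ModularSpan.

Section KrylovRelation.
Variables (A : comNzRingType) (p : nat) (charA : p \in [pchar A]) (a : nat).
Hypothesis a_gt0 : (0 < a)%N.
Variables (d : nat) (G : 'M[A]_d) (x : 'cV[A]_d).
Local Notation q := (p ^ a)%N.
Hypothesis krylov_neq0 : \det (krylov q G x) != 0.

Lemma krylov_relation_frac (F : fieldType) (iota : {rmorphism A -> F}) :
  injective iota ->
  exists P : 'cV[A]_d, siter q G x d = krylov q G x *m P.
Proof.
move=> iota_inj; have [d0|d_gt0] := posnP d.
  by exists 0; apply/colP=> k; have:= leq_ltn_trans (leq0n k) (ltn_ord k); rewrite {1}d0.
have p_gt1 : (1 < p)%N by rewrite prime_gt1 ?(pcharf_prime charA).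
have q_gt1 : (1 < q)%N by rewrite -{1}(expn0 p) ltn_exp2l.
have charF : p \in [pchar {poly F}].
  exact: (rmorph_pchar (polyC \o iota : {rmorphism A -> {poly F}})).
have charF' : p \in [pchar F] by apply: (rmorph_pchar iota).
pose K := map_mx iota (krylov q G x).
have detK : \det K != 0 by rewrite det_map_mx -(rmorph0 iota) (inj_eq iota_inj).
pose s i := map_mx iota (siter q G x i).
have Ks (k i : 'I_d) : K k i = s i k 0 by rewrite !mxE.
have [c Kc] : exists c, K *m c = s d.
  by exists (invmx K *m s d); rewrite mulKVmx // unitmxE unitfE.
pose N : {poly F} := \sum_(i < d) c i 0 *: 'X^(q ^ i).
pose M : {poly F} := 'X^(q ^ d) - N.
have szN : (size N < size ('X^(q ^ d) : {poly F}))%N.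
  rewrite size_polyXn ltnS; apply: leq_trans (size_sum _ _ _) _.
  apply/bigmax_leqP => i _; apply: leq_trans (size_scale_leq _ _) _.
  by rewrite size_polyXn ltn_exp2l.
have szM : size M = (q ^ d).+1 by rewrite size_polyDl ?size_polyN // size_polyXn.
have monM : M \is monic.
  by rewrite monicE lead_coefDl ?size_polyN // lead_coefXn.
pose PC n1 n2 (m : 'M[F]_(n1, n2)) := map_mx (@polyC F) m.
pose v : 'rV[{poly F}]_d := \row_i 'X^(q ^ i).
pose u := v *m PC _ _ (invmx K).
have uK : u *m PC _ _ K = v.
  by rewrite -mulmxA -map_mxM mulVmx ?map_mx1 ?mulmx1 // unitmxE unitfE.
have uKE (i : 'I_d) : (u *m PC _ _ (s i)) 0 0 = 'X^(q ^ i).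
  have:= congr1 (fun m : 'rV__ => m 0 i) uK; rewrite !mxE => <-.
  by apply: eq_bigr => k _; rewrite !mxE.
have uKd : (u *m PC _ _ (s d)) 0 0 = N.
  rewrite -Kc /PC map_mxM mulmxA -/(PC _ _ K) uK mxE.
  by apply: eq_bigr => i _; rewrite !mxE mulrC mul_polyC.
pose sg := powq charF a.
pose r := map_mx sg u - u *m PC _ _ (map_mx iota G).
(* [r] measures how far [u] is from satisfying $\sigma(u) = uG$; paired with $\sigma(s_i)$ it
   compares the values of [u] on two consecutive iterates. *)
have rK i : (r *m map_mx sg (PC _ _ (s i))) 0 0 =
    sg ((u *m PC _ _ (s i)) 0 0) - (u *m PC _ _ (s i.+1)) 0 0.
  rewrite mulmxBl [LHS]mxE [X in _ + X]mxE; congr (_ - _).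
    by rewrite -map_mxM mxE.
  have ->: s i.+1 = map_mx iota G *m map_mx (powq charF' a) (s i).
    rewrite /s siterS /sfrob map_mxM; congr (_ *m _).
    by apply/matrixP=> k l; rewrite !mxE /powq rmorphXn.
  have ->: map_mx sg (PC _ _ (s i)) = PC _ _ (map_mx (powq charF' a) (s i)).
    by apply/matrixP=> k l; rewrite !mxE /sg /powq rmorphXn.
  by rewrite -mulmxA -map_mxM.
(* Against the columns of $\sigma(K)$ the pairing is 0, except for the last column, where it is
   $T^{q^d} - N = M$. As $\sigma(K)$ is invertible, [M] divides [r]. *)
have Mr j : M %| r 0 j.
  have rKK : r = r *m map_mx sg (PC _ _ K) *m map_mx sg (PC _ _ (invmx K)).
    rewrite -mulmxA -map_mxM -map_mxM mulmxV ?map_mx1 ?mulmx1 //.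
    by rewrite unitmxE unitfE.
  rewrite rKK mxE; apply: (big_ind (fun f => M %| f)) => [|f g|i _].
  - by rewrite dvdp0.
  - exact: dvdp_add.
  apply: dvdp_mulr; have ->: (r *m map_mx sg (PC _ _ K)) 0 i =
      (r *m map_mx sg (PC _ _ (s i))) 0 0.
    by rewrite !mxE; apply: eq_bigr => k _; rewrite !mxE.
  rewrite rK uKE /sg /powq -exprM -expnSr.
  have := ltn_ord i; rewrite leq_eqVlt => /orP[/eqP Ed|lti].
    by rewrite Ed uKd dvdpp.
  by rewrite (uKE (Ordinal lti)) subrr dvdp0.
have uG j : M %| u 0 j ^+ q - \sum_k (iota (G k j))%:P * u 0 k.
  have:= Mr j; rewrite !mxE; set f := _ - _; set g := _ - _.
  suff ->: f = g by [].
  by congr (_ - _); apply: eq_bigr => k _; rewrite !mxE mulrC.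
have Xx : 'X = \sum_k (iota (x k 0))%:P * u 0 k.
  have ->: 'X = 'X^(q ^ Ordinal d_gt0) :> {poly F} by rewrite expr1.
  rewrite -uKE mxE.
  by apply: eq_bigr => k _; rewrite !mxE mulrC.
have [f Mf] := monic_descent q_gt1 uG monM szM Xx.
(* The coefficient of [M] at $T^{q^i}$ is $-c_i$, since distinct [i] give distinct exponents; hence
   the sign. *)
exists (\col_i - f`_(q ^ i)); apply/colP => k; apply: iota_inj.
have:= congr1 (fun m : 'cV__ => m k 0) Kc; rewrite /s !mxE rmorph_sum => <-.
apply: eq_bigr => i _; rewrite !mxE rmorphM; congr (_ * _).
have: M`_(q ^ i) = iota f`_(q ^ i) by rewrite Mf coef_map.
rewrite coefB coefXn eqn_exp2l // (ltn_eqF (ltn_ord i)) sub0r rmorphN => <-.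
rewrite opprK coef_sum (bigD1 i) //=. rewrite coefZ coefXn eqxx mulr1 big1 ?addr0 //.
move=> j /negPf ji; rewrite coefZ coefXn eqn_exp2l // eq_sym.
by rewrite (inj_eq val_inj) ji mulr0.
Qed.
End KrylovRelation.

Section Shift.
Variables (R : comNzRingType) (d : nat).

(** The nilpotent shift: each basis vector goes to the next one and the last goes to 0. Starting
    from the first basis vector, the iterates run through the standard basis. *)
Definition shift_mx : 'M[R]_d := \matrix_(i, j) (i == j.+1 :> nat)%:R.
Definition shift_vec : 'cV[R]_d := \col_i (i == 0 :> nat)%:R.

Lemma siter_shift q j : (0 < q)%N ->
  siter q shift_mx shift_vec j = \col_i (i == j :> nat)%:R.
Proof.
move=> q_gt0; have natX (b : bool) : b%:R ^+ q = b%:R :> R.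
  by case: b; rewrite ?expr1n // expr0n; case: q q_gt0.
elim: j => [//|j IHj]; rewrite siterS IHj.
apply/colP => i; rewrite !mxE.
have [ltjd|ledj] := ltnP j d; last first.
  have ->: (i == j.+1 :> nat) = false by have:= ltn_ord i; lia.
  rewrite big1 // => k _; rewrite !mxE.
  have ->: (k == j :> nat) = false by have:= ltn_ord k; lia.
  by rewrite natX mulr0.
rewrite (bigD1 (Ordinal ltjd)) //= !mxE /= natX eqxx mulr1 big1 ?addr0 // => k.
by rewrite !mxE -val_eqE => /negPf /= ->; rewrite natX mulr0.
Qed.

Lemma krylov_shift q : (0 < q)%N -> krylov q shift_mx shift_vec = 1%:M.
Proof. by move=> q0; apply/matrixP=> i j; rewrite !mxE siter_shift // mxE. Qed.

End Shift.

Lemma frac_embedding (A : idomainType) :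
  exists (F : fieldType) (iota : {rmorphism A -> F}), injective iota.
Proof.
by exists {fraction A}, (@tofrac A) => y z /eqP; rewrite tofrac_eq => /eqP.
Qed.

Lemma mmap_comp n (R S T : comNzRingType) (f : {rmorphism R -> S})
    (g : {rmorphism S -> T}) h (P : {mpoly R[n]}) :
  g (mmap f h P) = mmap (g \o f) (g \o h) P.
Proof.
rewrite /mmap rmorph_sum; apply: eq_bigr => m _; rewrite rmorphM; congr (_ * _).
by rewrite /mmap1 rmorph_prod; apply: eq_bigr => i _; rewrite rmorphXn.
Qed.

Lemma eq_mmap n (R S : comNzRingType) (f f' : R -> S) h h' (P : {mpoly R[n]}) :
  f =1 f' -> h =1 h' -> mmap f h P = mmap f' h' P.
Proof.
move=> eqf eqh; apply: eq_bigr => m _; rewrite eqf; congr (_ * _).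
by apply: eq_bigr => i _; rewrite eqh.
Qed.

(** * Specialization and deformation *)

Section Specialization.
Variables (K : fieldType) (p : nat) (charK : p \in [pchar K]) (a : nat).
Hypothesis a_gt0 : (0 < a)%N.
Local Notation q := (p ^ a)%N.

Lemma pow_pchar_gt0 : (0 < q)%N.
Proof. by rewrite expn_gt0 prime_gt0 ?(pcharf_prime charK). Qed.

Section Ring.
Variables (R : comNzRingType) (iota : {rmorphism K -> R}) (d : nat).
Variables (G : 'M[R]_d) (x : 'cV[R]_d).

Definition specialize : {mpoly {mpoly K[d]}[d * d]} -> R :=
  mmap (mmap iota (fun k => x k 0)) (fun k => mxvec G 0 k).

HB.instance Definition _ := GRing.RMorphism.on specialize.

Lemma specialize_mx : map_mx specialize (generic_mx K d) = G.
Proof.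
apply/matrixP => i j; rewrite !mxE; apply: etrans (mmapX _ _ _) _.
by rewrite mmap1U mxvecE.
Qed.

Lemma specialize_vec : map_mx specialize (generic_vec K d) = x.
Proof.
apply/colP => i; rewrite !mxE; apply: etrans (mmapC _ _ _) _.
apply: etrans (mmapX _ _ _) _.
by rewrite mmap1U.
Qed.

Definition gsemichar : 'cV[R]_d :=
  \col_i specialize (semichar_generic K q i).

End Ring.

Lemma generic_iterE d i :
  generic_iter K q d i = siter q (generic_mx K d) (generic_vec K d) i.
Proof. by elim: i => //= i ->. Qed.

Lemma relation_sum (R : comNzRingType) d (G : 'M[R]_d) x (it : nat -> 'cV[R]_d) :
    (forall i, it i = siter q G x i) ->
    (exists P : 'cV[R]_d, siter q G x d = krylov q G x *m P) ->
  exists P : 'I_d -> R, it d = \sum_(i < d) P i *: it i.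
Proof.
move=> itE [P EP]; exists (fun i => P i 0); rewrite itE EP krylov_mul.
by apply: eq_bigr => i _; rewrite itE.
Qed.

(** The determinant has image 1, so a single specialization to the shift is enough for it to be
    nonzero. *)
Lemma det_krylov_map (R S : comNzRingType) (f : {rmorphism R -> S}) d
    (G : 'M[R]_d) x :
  map_mx f G = shift_mx S d -> map_mx f x = shift_vec S d ->
  \det (krylov q G x) != 0.
Proof.
move=> fG fx; apply/eqP => /(congr1 f).
rewrite -det_map_mx map_krylov fG fx krylov_shift ?pow_pchar_gt0 // det1 rmorph0.
by move/eqP; rewrite oner_eq0.
Qed.

Definition gring d : comNzRingType := {mpoly {mpoly K[d]}[d * d]}.

Lemma gring_frac d : exists (F : fieldType) (iota : {rmorphism gring d -> F}),
  injective iota.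
Proof.
(* Unifying the two ring structures on iterated mpoly takes minutes, while the
   kernel's conversion check at Qed is immediate. *)
exact_no_check (frac_embedding {mpoly {mpoly K[d]}[d * d]}).
Qed.

Lemma gring_specialize d (G : 'M[K]_d) (x : 'cV[K]_d) :
  exists f : {rmorphism gring d -> K},
    map_mx f (generic_mx K d) = G /\ map_mx f (generic_vec K d) = x.
Proof.
exists (specialize idfun G x).
by split; [apply: specialize_mx | apply: specialize_vec].
Qed.

Lemma gring_relation d (G : 'M[gring d]_d) (x : 'cV[gring d]_d) :
    (exists f : {rmorphism gring d -> K}, map_mx f G = shift_mx K d /\
      map_mx f x = shift_vec K d) ->
  exists P : 'cV[gring d]_d, siter q G x d = krylov q G x *m P.
Proof.
move=> [f [fG fx]]; have [F [iota iota_inj]] := gring_frac d.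
have charA : p \in [pchar gring d].
  exact: (rmorph_pchar (@mpolyC _ _ \o @mpolyC d K)).
by apply: (krylov_relation_frac charA) iota_inj; last apply: det_krylov_map fx.
Qed.

(** The generic pair specializes to every pair over [K], in particular to the shift, so its Krylov
    determinant is nonzero. *)
Lemma generic_relation_exists d : exists P : 'I_d -> _, @generic_relation K q d P.
Proof.
apply: relation_sum (@generic_iterE d) _.
exact: (@gring_relation d (generic_mx K d) (generic_vec K d) (gring_specialize _ _)).
Qed.

Lemma semichar_genericP d : generic_relation q (@semichar_generic K q d).
Proof. exact: epsilon_spec (generic_relation_exists d). Qed.

(** A specialization of the generic identity. It survives where the Krylov determinant vanishes,
    although it no longer determines the coefficients there. *)
Lemma gsemichar_relation (R : comNzRingType) (iota : {rmorphism K -> R}) d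
    (G : 'M[R]_d) x :
  siter q G x d = krylov q G x *m gsemichar iota G x.
Proof.
have := semichar_genericP d; rewrite /generic_relation generic_iterE.
under eq_bigr do rewrite generic_iterE.
move/(congr1 (map_mx (specialize iota G x))).
rewrite map_siter specialize_mx specialize_vec => ->.
rewrite krylov_mul map_mx_sum; apply: eq_bigr => i _.
by rewrite map_mxZ map_siter specialize_mx specialize_vec mxE.
Qed.

Lemma gsemichar_unique (R : idomainType) (iota : {rmorphism K -> R}) d
    (G : 'M[R]_d) x (c : 'cV[R]_d) :
    \det (krylov q G x) != 0 -> siter q G x d = krylov q G x *m c ->
  c = gsemichar iota G x.
Proof.
move=> det_neq0; rewrite (gsemichar_relation iota) => /(congr1 (mulmx (\adj (krylov q G x)))).
rewrite !mulmxA mul_adj_mx !mul_scalar_mx => /colP Ec.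
by apply/colP => i; have:= Ec i; rewrite !mxE => /(mulfI det_neq0).
Qed.

(** Naturality in the ring: this transports identities from $K[t]$ to $K$ by evaluation at 0. *)
Lemma map_gsemichar (R S : comNzRingType) (iota : {rmorphism K -> R})
    (kappa : {rmorphism K -> S}) (f : {rmorphism R -> S}) d (G : 'M[R]_d) x :
    f \o iota =1 kappa ->
  map_mx f (gsemichar iota G x) = gsemichar kappa (map_mx f G) (map_mx f x).
Proof.
move=> fiota; apply/colP => i; rewrite !mxE /specialize mmap_comp.
apply: eq_mmap => [P|k] /=; last by rewrite -map_mxvec mxE.
by rewrite mmap_comp; apply: eq_mmap => // j; rewrite /= mxE.
Qed.

Lemma semichar_coefE d (G : 'M[K]_d) x i :
  semichar_coef q G x i = gsemichar idfun G x i 0.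
Proof.
rewrite mxE /semichar_coef /specialize /meval mmap_comp.
apply: eq_mmap => // k /=.
by rewrite mmapC.
Qed.

Definition deform m n (M0 M1 : 'M[K]_(m, n)) : 'M[{poly K}]_(m, n) :=
  map_mx polyC M0 + 'X *: map_mx polyC (M1 - M0).

Lemma deform_horner m n (M0 M1 : 'M[K]_(m, n)) c :
  map_mx (horner_eval c) (deform M0 M1) = M0 + c *: (M1 - M0).
Proof.
by apply/matrixP => i j; rewrite !mxE /horner_eval !hornerE.
Qed.

Lemma deform0 m n (M0 M1 : 'M[K]_(m, n)) :
  map_mx (horner_eval 0) (deform M0 M1) = M0.
Proof. by rewrite deform_horner scale0r addr0. Qed.

Lemma deform1 m n (M0 M1 : 'M[K]_(m, n)) :
  map_mx (horner_eval 1) (deform M0 M1) = M1.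
Proof. by rewrite deform_horner scale1r addrC subrK. Qed.

Lemma det_krylov_deform d (G : 'M[K]_d) x :
  \det (krylov q (deform G (shift_mx K d)) (deform x (shift_vec K d))) != 0.
Proof. by apply: (@det_krylov_map _ _ (horner_eval 1)); rewrite deform1. Qed.

End Specialization.

(** * Skew products and their action *)

Section Operators.
Variables (R : comNzRingType) (p : nat) (charR : p \in [pchar R]) (a : nat).

(* The product of K[X, sigma], over a ring that need not be a field. *)
Definition tmul (u v : {poly R}) : {poly R} :=
  \sum_(i < size u) u`_i *: (map_poly (powq charR (a * i)) v * 'X^i).

Lemma tmulE n (u v : {poly R}) : (size u <= n)%N ->
  tmul u v = \sum_(i < n) u`_i *: (map_poly (powq charR (a * i)) v * 'X^i).
Proof.
move=> le_un; rewrite /tmul (big_ord_widen n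
  (fun i => u`_i *: (map_poly (powq charR (a * i)) v * 'X^i))) //.
rewrite big_mkcond /=; apply: eq_bigr => i _; case: ltnP => // le_ui.
by rewrite nth_default // scale0r.
Qed.

Lemma tmul_top (u v : {poly R}) m n : (size u <= m.+1)%N -> (size v <= n.+1)%N ->
  (size (tmul u v) <= (m + n).+1)%N /\
  (tmul u v)`_(m + n) = u`_m * powq charR (a * m) v`_n.
Proof.
move=> lum lvn; rewrite (tmulE _ lum); split.
  apply: leq_trans (size_sum _ _ _) _; apply/bigmax_leqP => i _.
  apply: leq_trans (size_scale_leq _ _) _; apply: leq_trans (size_polyMleq _ _) _.
  have szv : (size (map_poly (powq charR (a * i)) v) <= n.+1)%N.
    exact: leq_trans (size_poly _ _) lvn.
  by rewrite size_polyXn; have := ltn_ord i; lia.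
rewrite coef_sum big_ord_recr /= big1 ?add0r => [|i _].
  by rewrite coefZ coefMXn ltnNge leq_addr /= addKn coef_map.
rewrite coefZ coefMXn ltnNge (leq_trans (ltnW (ltn_ord i))) ?leq_addr //=.
rewrite coef_map /=; have -> : v`_(m + n - i) = 0.
  by rewrite nth_default //; apply: leq_trans lvn _; have := ltn_ord i; lia.
by rewrite rmorph0 mulr0.
Qed.

Variables (E : lmodType R) (Phi : E -> E).

Definition semilinear_map := forall c v w,
  Phi (c *: v + w) = powq charR a c *: Phi v + Phi w.

Definition act (u : {poly R}) (v : E) : E := \sum_(i < size u) u`_i *: iter i Phi v.

Lemma actE n (u : {poly R}) v : (size u <= n)%N -> act u v = \sum_(i < n) u`_i *: iter i Phi v.
Proof.
move=> le_un; rewrite /act (big_ord_widen n (fun i => u`_i *: iter i Phi v)) //.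
rewrite big_mkcond /=; apply: eq_bigr => i _; case: ltnP => // le_ui.
by rewrite nth_default // scale0r.
Qed.

Lemma actD u w v : act (u + w) v = act u v + act w v.
Proof.
pose n := maxn (size u) (size w).
rewrite (@actE n (u + w)) ?size_polyD // (@actE n u) ?leq_maxl //.
rewrite (@actE n w) ?leq_maxr // -big_split; apply: eq_bigr => i _ /=.
by rewrite coefD scalerDl.
Qed.

Lemma actZ c u v : act (c *: u) v = c *: act u v.
Proof.
rewrite (@actE (size u)) ?size_scale_leq // scaler_sumr; apply: eq_bigr => i _.
by rewrite coefZ scalerA.
Qed.

Lemma actN u v : act (- u) v = - act u v.
Proof. by rewrite -[- u]scaleN1r actZ scaleN1r. Qed.

Lemma act0 v : act 0 v = 0.
Proof. by rewrite /act size_poly0 big_ord0. Qed.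

Lemma act_sum (I : finType) (u : I -> {poly R}) v :
  act (\sum_i u i) v = \sum_i act (u i) v.
Proof. by apply: (big_morph (act^~ v)) => [u1 u2|]; rewrite ?act0 ?actD. Qed.

Lemma actXn i v : act 'X^i v = iter i Phi v.
Proof.
rewrite (@actE i.+1) ?size_polyXn // big_ord_recr big1 /= ?add0r => [|j _].
  by rewrite coefXn eqxx scale1r.
by rewrite coefXn ltn_eqF // scale0r.
Qed.

Hypothesis PhiP : semilinear_map.

Lemma semilinear0 : Phi 0 = 0.
Proof.
by have /eqP := PhiP (-1) 0 0; rewrite scaler0 addr0 rmorphN1 scaleN1r addNr => /eqP.
Qed.

Lemma semilinearD v w : Phi (v + w) = Phi v + Phi w.
Proof. by have := PhiP 1 v w; rewrite rmorph1 !scale1r. Qed.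

Lemma semilinearZ c v : Phi (c *: v) = powq charR a c *: Phi v.
Proof. by have := PhiP c v 0; rewrite semilinear0 !addr0. Qed.

Lemma semilinear_sum (I : finType) (v : I -> E) :
  Phi (\sum_i v i) = \sum_i Phi (v i).
Proof. by apply: (big_morph Phi) => [v1 v2|]; rewrite ?semilinear0 ?semilinearD. Qed.

End Operators.

Section OperatorsMul.
Variables (R : comNzRingType) (p : nat) (charR : p \in [pchar R]) (a : nat).
Variables (E : lmodType R) (Phi : E -> E).
Hypothesis PhiP : semilinear_map charR a Phi.

Lemma semilinear_iter i : semilinear_map charR (a * i) (iter i Phi).
Proof.
elim: i => [|i IHi] c v w; first by rewrite muln0 /powq expn0 expr1.
by rewrite iterS IHi PhiP /powq -exprM -expnD mulnS addnC.
Qed.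

(** The twist in [tmul] is exactly the scalar rule $\Phi^i(cv) = \sigma^i(c)\Phi^i(v)$. *)
Lemma act_tmul u w v : act Phi (tmul charR a u w) v = act Phi u (act Phi w v).
Proof.
rewrite /tmul act_sum; apply: eq_bigr => i _; rewrite actZ; congr (_ *: _).
have Phii := semilinear_iter i.
rewrite -[w in LHS]coefK poly_def rmorph_sum mulr_suml act_sum.
rewrite [RHS](semilinear_sum Phii); apply: eq_bigr => j _.
rewrite (semilinearZ Phii) /= map_polyZ map_polyXn -scalerAl -exprD actZ actXn.
by rewrite addnC iterD.
Qed.

Lemma act_intertwine (E' : lmodType R) (Phi' : E' -> E') (L : {linear E -> E'}) :
  (forall v, L (Phi v) = Phi' (L v)) -> forall u v, L (act Phi u v) = act Phi' u (L v).
Proof.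
move=> LPhi u v; rewrite linear_sum; apply: eq_bigr => i _; rewrite linearZ.
by congr (_ *: _); elim: (i : nat) => //= n <-.
Qed.

End OperatorsMul.

Definition cpoly (R : nzRingType) d (s : 'cV[R]_d) : {poly R} :=
  'X^d - \sum_(i < d) s i 0 *: 'X^i.

Section CPoly.
Variable R : comNzRingType.

Lemma coef_cpoly d (s : 'cV[R]_d) : (cpoly s)`_d = 1.
Proof.
rewrite coefB coefXn eqxx coef_sum big1 ?subr0 // => i _.
by rewrite coefZ coefXn gtn_eqF // mulr0.
Qed.

Lemma coef_cpoly_ord d (s : 'cV[R]_d) (i : 'I_d) : (cpoly s)`_i = - (s i 0).
Proof.
rewrite coefB coefXn ltn_eqF // sub0r coef_sum (bigD1 i) //= coefZ coefXn eqxx.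
rewrite mulr1 big1 ?addr0 // => j; rewrite -val_eqE coefZ coefXn eq_sym => /negPf ->.
by rewrite mulr0.
Qed.

Lemma size_cpoly d (s : 'cV[R]_d) : size (cpoly s) = d.+1.
Proof.
have szS : (size (\sum_(i < d) s i 0 *: 'X^i)%R < d.+1)%N.
  rewrite ltnS; apply: leq_trans (size_sum _ _ _) _; apply/bigmax_leqP => i _.
  by apply: leq_trans (size_scale_leq _ _) _; rewrite size_polyXn.
by rewrite size_polyDl ?size_polyN size_polyXn.
Qed.

Lemma cpolyP d (u : {poly R}) : (size u <= d.+1)%N -> u`_d = 1 ->
  exists s : 'cV_d, u = cpoly s.
Proof.
move=> leud ud; exists (\col_i - u`_i); apply/polyP => i.
have [ltid|] := ltnP i d; last rewrite leq_eqVlt => /orP[/eqP <-|ltdi].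
- by rewrite (coef_cpoly_ord _ (Ordinal ltid)) mxE opprK.
- by rewrite coef_cpoly.
by rewrite !nth_default ?size_cpoly // (leq_trans leud).
Qed.

Lemma act_cpoly (E : lmodType R) (Phi : E -> E) d (s : 'cV[R]_d) v :
  act Phi (cpoly s) v = iter d Phi v - \sum_(i < d) s i 0 *: iter i Phi v.
Proof.
rewrite /cpoly actD actN act_sum actXn; congr (_ - _).
by apply: eq_bigr => i _; rewrite actZ actXn.
Qed.

Lemma tmul_cpoly p (charR : p \in [pchar R]) a d2 d1 (s : 'cV[R]_d2) (t : 'cV[R]_d1) :
  exists r : 'cV_(d2 + d1), tmul charR a (cpoly t) (cpoly s) = cpoly r.
Proof.
have [|| sz lc] := @tmul_top R p charR a (cpoly t) (cpoly s) d1 d2; rewrite ?size_cpoly //.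
by apply: cpolyP; rewrite addnC // lc !coef_cpoly rmorph1 mulr1.
Qed.

End CPoly.

Section MapPoly.
Variables (R S : comNzRingType) (f : {rmorphism R -> S}).

Lemma map_cpoly d (s : 'cV[R]_d) : map_poly f (cpoly s) = cpoly (map_mx f s).
Proof.
rewrite rmorphB rmorph_sum /= map_polyXn; congr (_ - _); apply: eq_bigr => i _.
by rewrite /= map_polyZ map_polyXn mxE.
Qed.

Lemma map_tmul p (charR : p \in [pchar R]) (charS : p \in [pchar S]) a (u v : {poly R}) :
  map_poly f (tmul charR a u v) = tmul charS a (map_poly f u) (map_poly f v).
Proof.
rewrite (@tmulE _ _ charS _ (size u)) ?size_poly // rmorph_sum.
apply: eq_bigr => i _; rewrite /= map_polyZ rmorphM /= map_polyXn coef_map.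
congr (_ *: (_ * _)); apply/polyP => j; rewrite !coef_map /powq /=.
by rewrite rmorphXn.
Qed.

Lemma map_act q d (G : 'M[R]_d) (u : {poly R}) x :
  map_mx f (act (sfrob q G) u x) =
  act (sfrob q (map_mx f G)) (map_poly f u) (map_mx f x).
Proof.
rewrite [RHS](@actE _ _ _ (size u)) ?size_poly // map_mx_sum.
by apply: eq_bigr => i _; rewrite map_mxZ coef_map [map_mx f (iter _ _ _)]map_siter.
Qed.

End MapPoly.

(** * Factorization and change of basis on matrices *)

Section BlockTriangular.
Variables (K : fieldType) (p : nat) (charK : p \in [pchar K]) (a : nat).
Hypothesis a_gt0 : (0 < a)%N.
Local Notation q := (p ^ a)%N.
Local Notation gsc := (gsemichar p a).

Lemma sfrob_semilinear (R : comNzRingType) (charR : p \in [pchar R]) d (G : 'M[R]_d) :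
  semilinear_map charR a (sfrob q G).
Proof.
move=> c v w; rewrite /sfrob scalemxAr -mulmxDr; congr (_ *m _).
by apply/matrixP => i j; rewrite !mxE -/(powq charR a _) rmorphD rmorphM.
Qed.

Lemma act_gsemichar (R : comNzRingType) (iota : {rmorphism K -> R}) d
    (G : 'M[R]_d) x :
  act (sfrob q G) (cpoly (gsc iota G x)) x = 0.
Proof.
rewrite act_cpoly; have := gsemichar_relation charK a_gt0 iota G x.
by rewrite krylov_mul /siter => ->; rewrite subrr.
Qed.

Lemma block_usubmx (R : comNzRingType) d2 d1 (G : 'M[R]_(d2 + d1)) :
    ursubmx G = 0 ->
  G = block_mx (ulsubmx G) 0 (dlsubmx G) (drsubmx G).
Proof. by move=> <-; rewrite submxK. Qed.

(** When the upper right block is zero, the last [d1] coordinates carry a submodule and the first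
    [d2] are coordinates on the quotient; [usubmx] is the quotient map. *)
Lemma usubmx_act (R : comNzRingType) d2 d1 (G : 'M[R]_(d2 + d1)) (u : {poly R}) x :
    ursubmx G = 0 ->
  usubmx (act (sfrob q G) u x) = act (sfrob q (ulsubmx G)) u (usubmx x).
Proof.
move=> G0; apply: act_intertwine => v /=.
rewrite /sfrob {1}(block_usubmx G0) -[in LHS](vsubmxK v) map_col_mx mul_block_col.
by rewrite col_mxKu mul0mx addr0.
Qed.

Section Domain.
Variables (R : idomainType) (iota : {rmorphism K -> R}).

(** The right factor kills [x] in the quotient, so it sends [x] to a vector [y] of the submodule,
    which the left factor kills. The product is thus a monic annihilator of degree [d2 + d1], and
    [gsemichar_unique] identifies it. *)
Lemma gsemichar_block_domain d2 d1 (G : 'M[R]_(d2 + d1)) x :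
    \det (krylov q G x) != 0 -> ursubmx G = 0 ->
  let s := gsc iota (ulsubmx G) (usubmx x) in
  let y := act (sfrob q G) (cpoly s) x in
  let charR := rmorph_pchar iota charK in
  cpoly (gsc iota G x) =
  tmul charR a (cpoly (gsc iota (drsubmx G) (dsubmx y))) (cpoly s).
Proof.
move=> detG G0 s y charR; set t := gsc iota (drsubmx G) (dsubmx y).
have [r Er] := tmul_cpoly charR a s t; rewrite Er; congr cpoly; symmetry.
apply: (gsemichar_unique charK a_gt0) => //.
have y0 : usubmx y = 0 by rewrite usubmx_act // act_gsemichar.
(* [J] is the inclusion of the submodule; [GJ] says that it commutes with the semilinear maps. *)
pose J : 'M[R]_(d2 + d1, d1) := col_mx 0 1%:M.
have GJ (v : 'cV_d1) : J *m sfrob q (drsubmx G) v = sfrob q G (J *m v).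
  rewrite /J !mul_col_mx !mul0mx !mul1mx /sfrob {2}(block_usubmx G0) map_col_mx mul_block_col.
  rewrite (_ : map_mx _ 0 = 0) ?mulmx0 ?mul0mx ?add0r //.
  by apply/matrixP => i j; rewrite !mxE -/(powq charR a _) rmorph0.
have yJ : y = J *m dsubmx y.
  by rewrite -{1}[y]vsubmxK y0 /J mul_col_mx mul0mx mul1mx.
have: act (sfrob q G) (cpoly r) x = 0.
  rewrite -Er (act_tmul (sfrob_semilinear charR G)) -/y yJ.
  rewrite -(act_intertwine (Phi := sfrob q (drsubmx G)) (L := mulmx J) GJ).
  by rewrite act_gsemichar raddf0.
by rewrite act_cpoly => /eqP; rewrite subr_eq0 krylov_mul => /eqP.
Qed.

(** [Q] carries the iterates of [x] under [G] to those of [Q *m x] under [G'], so both families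
    satisfy the same relation. *)
Lemma gsemichar_conj_domain d (G G' : 'M[R]_d) Q (x : 'cV[R]_d) :
    \det Q * \det (krylov q G x) != 0 ->
    Q *m G = G' *m map_mx (fun y => y ^+ q) Q ->
  gsc iota G' (Q *m x) = gsc iota G x.
Proof.
move=> detQG QG; have charR := rmorph_pchar iota charK.
have iterQ i : siter q G' (Q *m x) i = Q *m siter q G x i.
  elim: i => // i IHi; rewrite !siterS IHi /sfrob mulmxA QG -mulmxA; congr (_ *m _).
  by apply: (map_mxM (powq charR a)).
have KQ : krylov q G' (Q *m x) = Q *m krylov q G x.
  apply/matrixP => i j; rewrite !mxE iterQ mxE.
  by apply: eq_bigr => k _; rewrite mxE.
symmetry; apply: (gsemichar_unique charK a_gt0); first by rewrite KQ det_mulmx.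
rewrite iterQ (gsemichar_relation charK a_gt0 iota) mulmxA.
by rewrite KQ.
Qed.

End Domain.

Lemma gsemichar_deform d (G : 'M[K]_d) x (Gt : 'M[{poly K}]_d) xt :
    map_mx (horner_eval 0) Gt = G -> map_mx (horner_eval 0) xt = x ->
  map_mx (horner_eval 0) (gsc polyC Gt xt) = gsc idfun G x.
Proof.
move=> <- <-; apply: map_gsemichar => c.
by rewrite /= /horner_eval hornerC.
Qed.

Lemma gsemichar_block d2 d1 (G : 'M[K]_(d2 + d1)) x : ursubmx G = 0 ->
  let s := gsc idfun (ulsubmx G) (usubmx x) in
  let y := act (sfrob q G) (cpoly s) x in
  cpoly (gsc idfun G x) =
  tmul charK a (cpoly (gsc idfun (drsubmx G) (dsubmx y))) (cpoly s).
Proof.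
move=> G0 s y; pose Gt := deform G (shift_mx K _); pose xt := deform x (shift_vec K _).
(* The shift is strictly lower triangular, so the deformation preserves the block shape. *)
have Gt0 : ursubmx Gt = 0.
  apply/matrixP => i j; have /matrixP/(_ i j) := G0; rewrite !mxE => ->.
  by rewrite /= ltn_eqF ?subrr ?polyC0 ?mulr0 ?addr0 // ltnS
    (leq_trans (ltnW (ltn_ord i))) ?leq_addr.
have := gsemichar_block_domain polyC (det_krylov_deform charK a G x) Gt0.
rewrite -/Gt -/xt => /(congr1 (map_poly (horner_eval 0))).
rewrite map_cpoly (map_tmul (horner_eval 0) _ charK) !map_cpoly.
rewrite (gsemichar_deform (deform0 _ _) (deform0 _ _)) => ->.
have Es : map_mx (horner_eval 0) (gsc polyC (ulsubmx Gt) (usubmx xt)) = s.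
  by apply: gsemichar_deform; rewrite ?map_ulsubmx ?map_usubmx deform0.
rewrite Es; congr (tmul charK a (cpoly _) _); apply: gsemichar_deform.
  by rewrite map_drsubmx deform0.
by rewrite map_dsubmx map_act map_cpoly Es !deform0.
Qed.

Lemma gsemichar_conj d (G G' : 'M[K]_d) Q (x : 'cV[K]_d) :
    Q \in unitmx -> Q *m G = G' *m map_mx (fun y => y ^+ q) Q ->
  gsc idfun G' (Q *m x) = gsc idfun G x.
Proof.
move=> unitQ QG; pose Gt := deform G (shift_mx K _); pose xt := deform x (shift_vec K _).
pose sQ := map_mx (powq charK a) Q.
have unitsQ : sQ \in unitmx by rewrite map_unitmx.
(* [Q] stays constant. The twisted conjugation relation then forces this deformation of [G'], whose
   value at 0 is [G']. *)
pose Ht := map_mx polyC Q *m Gt *m map_mx polyC (invmx sQ).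
have hC m n (M : 'M[K]_(m, n)) : map_mx (horner_eval 0) (map_mx polyC M) = M.
  by apply/matrixP => i j; rewrite !mxE /horner_eval hornerC.
have E := @gsemichar_conj_domain _ polyC _ Gt Ht (map_mx polyC Q) xt.
have <- : map_mx (horner_eval 0) (gsc polyC Gt xt) = gsc idfun G x.
  by apply: gsemichar_deform; apply: deform0.
rewrite -E.
- symmetry; apply: gsemichar_deform; last by rewrite map_mxM deform0 hC.
  by rewrite !map_mxM !hC deform0 QG -/sQ mulmxK.
- rewrite mulf_neq0 ?det_krylov_deform // det_map_mx polyC_eq0.
  by rewrite -unitfE -unitmxE.
have -> : map_mx (fun y => y ^+ q) (map_mx polyC Q) = map_mx polyC sQ.
  by apply/matrixP => i j; rewrite !mxE polyC_exp.
by rewrite -mulmxA -map_mxM mulVmx // map_mx1 mulmx1.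
Qed.

End BlockTriangular.

(** * Degrees and units in the skew polynomial ring *)

Section SkewPolynomials.
Variables (K : fieldType) (p : nat) (charK : p \in [pchar K]) (a : nat).
Local Notation S := (skewpoly (frobq charK a)).
Local Notation tmul := (tmul charK a).

Lemma skew_mul_tmul (u v : {poly K}) : (u : S) * (v : S) = tmul u v.
Proof.
apply: eq_bigr => i _; congr (_ *: (_ * _)); apply: eq_map_poly => y.
rewrite /sigman; elim: (i : nat) => [|n IHn]; first by rewrite muln0 /powq expr1.
by rewrite iterS IHn /= /frobq /powq -exprM -expnD mulnS addnC.
Qed.

Lemma powq_eq0 i (y : K) : (powq charK i y == 0) = (y == 0).
Proof. exact: fmorph_eq0. Qed.

(** The Frobenius is injective on a field, so the product of the leading terms does not vanish. *)
Lemma size_tmul (u v : {poly K}) : u != 0 -> v != 0 ->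
  size (tmul u v) = (size u + size v).-1.
Proof.
move=> u0 v0; have su : size u = (size u).-1.+1 by rewrite prednK // size_poly_gt0.
have sv : size v = (size v).-1.+1 by rewrite prednK // size_poly_gt0.
have [|| lt lc] := @tmul_top K p charK a u v (size u).-1 (size v).-1; rewrite -?su -?sv //.
have -> : (size u + size v).-1 = ((size u).-1 + (size v).-1).+1 by lia.
apply/eqP; rewrite eqn_leq lt ltnNge; apply/negP => /(nth_default 0) /eqP.
by rewrite lc mulf_eq0 powq_eq0 -/(lead_coef u) -/(lead_coef v) !lead_coef_eq0
  (negPf u0) (negPf v0).
Qed.

Lemma invertible_size1 (u : {poly K}) : size u = 1%N -> invertible (u : S).
Proof.
move=> /eqP/size_poly1P[c c0 ->].
have tmulCC b e : tmul b%:P e%:P = (b * e)%:P.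
  rewrite (@tmulE _ _ _ _ 1) ?size_polyC_leq1 // big_ord1 coefC map_polyC.
  rewrite /= muln0 /powq expn0 expr1 mulr1.
  by rewrite -mul_polyC polyCM.
exists (c^-1)%:P; rewrite !skew_mul_tmul.
by split; apply: etrans (tmulCC _ _) _; rewrite ?mulfV ?mulVf.
Qed.

Lemma size_invertible (u : {poly K}) : invertible (u : S) -> size u = 1%N.
Proof.
have [-> [v [+ _]]|u0 [v [+ _]]] := eqVneq u 0.
  by rewrite mul0r => /esym/eqP; rewrite oner_eq0.
have [->|v0] := eqVneq v 0; first by rewrite mulr0 => /esym/eqP; rewrite oner_eq0.
rewrite skew_mul_tmul => uv1.
have : size (tmul u v) = 1%N by rewrite uv1 size_poly1.
rewrite size_tmul //; by move: u0 v0; rewrite -!size_poly_gt0; lia.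
Qed.

End SkewPolynomials.

(** * Simple modules *)

Section StableSpan.
Variables (K : fieldType) (p : nat) (charK : p \in [pchar K]) (a : nat).
Variables (V : vectType K) (phi : V -> V).
Hypothesis phiP : semilinear_map charK a phi.

Lemma stable_iter (U : {vspace V}) v i :
  phi_stable phi U -> v \in U -> iter i phi v \in U.
Proof. by move=> Us Uv; elim: i => //= i /Us. Qed.

Lemma stable_act (U : {vspace V}) (u : {poly K}) v :
  phi_stable phi U -> v \in U -> act phi u v \in U.
Proof.
by move=> Us Uv; apply: rpred_sum => i _; rewrite rpredZ // stable_iter.
Qed.

Definition krylov_space (S : {vspace V}) v k : {vspace V} :=
  (S + <<[seq iter i phi v | i <- iota 0 k]>>)%VS.

Lemma dim_krylov_space S v k : (\dim (krylov_space S v k) <= \dim S + k)%N.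
Proof.
apply: leq_trans (dimv_add_leqif _ _) _.
by rewrite leq_add2l (leq_trans (dim_span _)) // size_map size_iota.
Qed.

Lemma krylov_spaceS S v k : (S <= krylov_space S v k)%VS.
Proof. exact: addvSl. Qed.

Lemma mem_krylov_space S v k i : (i < k)%N -> iter i phi v \in krylov_space S v k.
Proof.
move=> ltik; apply: (subvP (addvSr _ _)); apply: memv_span; apply/mapP.
by exists i => //; rewrite mem_iota.
Qed.

(** [phi] moves each spanning iterate to the next; only the last one calls on the hypothesis. For
    [k = 0] the hypothesis is itself the membership of [v]. *)
Lemma krylov_space_stable S v k :
    phi_stable phi S -> iter k phi v \in krylov_space S v k ->
  phi_stable phi (krylov_space S v k) /\ v \in krylov_space S v k.
Proof.
move=> Ss vk; split; last first.
  by case: k vk => // k _; apply: (@mem_krylov_space S v k.+1 0).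
move=> _ /memv_addP[s Ss' [w /coord_span -> ->]].
rewrite (semilinearD phiP) rpredD //.
  by apply: (subvP (krylov_spaceS _ _ _)); apply: Ss.
rewrite (semilinear_sum phiP) rpred_sum // => i _.
rewrite (semilinearZ phiP) rpredZ //.
rewrite /= (nth_map 0%N) ?size_iota // nth_iota // add0n -iterS.
by have := ltn_ord i; rewrite leq_eqVlt => /orP[/eqP -> //|]; apply: mem_krylov_space.
Qed.

End StableSpan.

Section SimpleModules.
Variables (K : fieldType) (p : nat) (charK : p \in [pchar K]) (a : nat).
Hypothesis a_gt0 : (0 < a)%N.
Variables (V : vectType K) (phi : V -> V).
Hypothesis phiP : semilinear_map charK a phi.
Local Notation d := (\dim {: V}).
Local Notation q := (p ^ a)%N.

Lemma semicharE n (B : n.-tuple V) v :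
  semichar charK a phi B v =
  cpoly (gsemichar p a idfun (phi_mx phi B) (coord_vec B v)) :> {poly K}.
Proof.
rewrite /semichar; have XE i : (skewX (frobq charK a)) ^+ i = 'X^i :> {poly K}.
  elim: i => // i IHi; rewrite exprS [LHS]skew_mul_tmul IHi.
  rewrite (@tmulE _ _ _ _ 2) ?size_polyX // big_ord_recl big_ord1 !coefX scale0r add0r.
  by rewrite scale1r map_polyXn -exprD addnC.
rewrite XE; congr (_ - _); apply: eq_bigr => i _.
rewrite XE [LHS]skew_mul_tmul (@tmulE _ _ _ _ 1) ?size_polyC_leq1 // big_ord1 coefC.
by rewrite map_polyXn mulr1 semichar_coefE.
Qed.

Lemma size_semichar n (B : n.-tuple V) v :
  size (semichar charK a phi B v : {poly K}) = n.+1.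
Proof. by rewrite semicharE size_cpoly. Qed.

(** Otherwise, with [k] the degree of [u], $\varphi^k(v)$ is a combination of the earlier iterates.
    These span a stable subspace of dimension at most [k], hence less than $d$, which contains [v];
    this contradicts simplicity. *)
Lemma act_simple_neq0 (u : {poly K}) v :
    phi_simple phi -> v != 0 -> u != 0 -> (size u <= d)%N ->
  act phi u v != 0.
Proof.
move=> [_ simple_phi] v0 u0 leud; apply/eqP => uv0.
pose k := (size u).-1; have su : size u = k.+1 by rewrite prednK // size_poly_gt0.
have S0 : phi_stable phi 0%VS by move=> w; rewrite !memv0 => /eqP ->; rewrite (semilinear0 phiP).
have [||st vS] := @krylov_space_stable _ _ charK a V phi phiP 0%VS v k => //.
  have uk : u`_k != 0 by rewrite -/(lead_coef u) lead_coef_eq0.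
  rewrite -[iter k phi v]scale1r -(mulVf uk) -scalerA rpredZ //.
  have := uv0; rewrite (@actE _ _ _ k.+1) ?su // big_ord_recr /= addrC => /eqP.
  rewrite addr_eq0 => /eqP ->; rewrite rpredN rpred_sum // => i _.
  by rewrite rpredZ // mem_krylov_space.
have [E|E] := simple_phi _ st.
  by move: vS; rewrite E memv0 (negPf v0).
have := dim_krylov_space phi 0 v k; rewrite E dimv0 add0n => /(leq_trans leud).
by rewrite su ltnn.
Qed.

End SimpleModules.

(** * Coordinates in a basis of a stable subspace *)

Section Coordinates.
Variables (K : fieldType) (p : nat) (charK : p \in [pchar K]) (a : nat).
Hypothesis a_gt0 : (0 < a)%N.
Variables (V : vectType K) (phi : V -> V).
Hypothesis phiP : semilinear_map charK a phi.
Local Notation q := (p ^ a)%N.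
Variables (U : {vspace V}).
Hypothesis U_stable : phi_stable phi U.

Lemma coord_vec_sum d (X : d.-tuple V) v : basis_of U X -> v \in U ->
  v = \sum_i coord_vec X v i 0 *: tnth X i.
Proof.
move=> bX Uv; rewrite {1}(coord_basis bX Uv).
by apply: eq_bigr => i _; rewrite mxE (tnth_nth 0).
Qed.

Lemma coord_vec_linear d (X : d.-tuple V) : linear (coord_vec X).
Proof. by move=> c u v; apply/colP => i; rewrite !mxE linearP. Qed.

Lemma coord_vec_phi d (X : d.-tuple V) v : basis_of U X -> v \in U ->
  coord_vec X (phi v) = sfrob q (phi_mx phi X) (coord_vec X v).
Proof.
move=> bX Uv; apply/colP => i; rewrite !mxE {1}(coord_vec_sum bX Uv).
rewrite (semilinear_sum phiP) linear_sum; apply: eq_bigr => j _.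
by rewrite (semilinearZ phiP) linearZ /= !mxE mulrC.
Qed.

Lemma coord_vec_iter d (X : d.-tuple V) v i : basis_of U X -> v \in U ->
  coord_vec X (iter i phi v) = siter q (phi_mx phi X) (coord_vec X v) i.
Proof.
move=> bX Uv; elim: i => // i IHi.
by rewrite iterS siterS -IHi coord_vec_phi // stable_iter.
Qed.

Lemma coord_vec_act d (X : d.-tuple V) (u : {poly K}) v : basis_of U X -> v \in U ->
  coord_vec X (act phi u v) = act (sfrob q (phi_mx phi X)) u (coord_vec X v).
Proof.
move=> bX Uv; rewrite /act.
pose L : {linear V -> 'cV[K]_d} := HB.pack (coord_vec X)
  (GRing.isLinear.Build K V 'cV[K]_d _ (coord_vec X) (@coord_vec_linear _ X)).
rewrite -[LHS]/(L _) linear_sum; apply: eq_bigr => i _.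
by rewrite linearZ /= coord_vec_iter.
Qed.

Lemma coord_vec_inj d (X : d.-tuple V) v w : basis_of U X -> v \in U -> w \in U ->
  coord_vec X v = coord_vec X w -> v = w.
Proof.
by move=> bX Uv Uw E; rewrite (coord_vec_sum bX Uv) (coord_vec_sum bX Uw) E.
Qed.

Lemma act_semichar d (X : d.-tuple V) v : basis_of U X -> v \in U ->
  act phi (semichar charK a phi X v) v = 0.
Proof.
move=> bX Uv; apply: (coord_vec_inj bX); rewrite ?mem0v ?stable_act //.
rewrite coord_vec_act // semicharE (act_gsemichar charK a_gt0).
by apply/colP => i; rewrite !mxE linear0.
Qed.

(** With a basis of the stable subspace [U], [semichar] is the polynomial of the restriction of
    [phi] to [U], so submodules are treated inside [V]. The change of basis matrix satisfies the
    twisted relation of [gsemichar_conj]. *)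
Lemma semichar_basis d d' (X : d.-tuple V) (Y : d'.-tuple V) v :
    basis_of U X -> basis_of U Y -> v \in U ->
  semichar charK a phi X v = semichar charK a phi Y v.
Proof.
move=> bX bY Uv.
have Edd : d = d' by rewrite -(vector.size_basis bX) (vector.size_basis bY).
case: _ / Edd Y bY => Y bY {d'}.
have UX j : tnth X j \in U by apply: (basis_mem bX); rewrite mem_tnth.
have UY j : tnth Y j \in U by apply: (basis_mem bY); rewrite mem_tnth.
have change (Z T : d.-tuple V) w : basis_of U Z -> basis_of U T -> w \in U ->
    coord_vec T w = (\matrix_(i, j) coord T i (tnth Z j)) *m coord_vec Z w.
  move=> bZ bT Uw; apply/colP => i; rewrite !mxE {1}(coord_vec_sum bZ Uw) linear_sum.
  by apply: eq_bigr => j _; rewrite linearZ !mxE mulrC.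
pose Q := \matrix_(i, j) coord Y i (tnth X j).
pose Q' := \matrix_(i, j) coord X i (tnth Y j).
have QQ' : Q *m Q' = 1%:M.
  apply/matrixP => i j; have /colP/(_ i) := change X Y (tnth Y j) bX bY (UY j).
  rewrite mxE (tnth_nth 0) coord_free ?(basis_free bY) // => E.
  rewrite [RHS]mxE eq_sym -val_eqE E !mxE.
  by apply: eq_bigr => k _; rewrite /Q /Q' !mxE (tnth_nth 0 Y).
have unitQ : Q \in unitmx by have [] := mulmx1_unit QQ'.
rewrite [LHS]semicharE [RHS]semicharE.
congr cpoly; rewrite (change X Y v) //; symmetry.
apply: (gsemichar_conj charK a_gt0) => //.
have colE j : col j Q = coord_vec Y (tnth X j) by apply/colP => i; rewrite !mxE.
apply/matrixP => i j.
have /colP/(_ i) := change X Y (phi (tnth X j)) bX bY (U_stable (UX j)).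
rewrite coord_vec_phi // -colE !mxE => E.
transitivity (\sum_k Q i k * coord_vec X (phi (tnth X j)) k 0).
  by apply: eq_bigr => k _; rewrite /Q !mxE.
by rewrite -E; apply: eq_bigr => k _; rewrite /Q !mxE.
Qed.

End Coordinates.

(** * Irreducibility over a simple module *)

Section Irreducibility.
Variables (K : fieldType) (p : nat) (charK : p \in [pchar K]) (a : nat).
Hypothesis a_gt0 : (0 < a)%N.
Local Notation S := (skewpoly (frobq charK a)).

Lemma irreducible_skew (u : {poly K}) : (1 < size u)%N ->
    (forall v w : {poly K}, u = tmul charK a v w -> v != 0 -> w != 0 ->
      size u = (size v + size w).-1 -> size v = 1%N \/ size w = 1%N) ->
  irreducible_elt (u : S).
Proof.
move=> szu irr; split => [u0|/size_invertible us|v w Eu].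
- by move: szu; rewrite u0 size_poly0.
- by move: szu; rewrite us.
have u0 : u != 0 by rewrite -size_poly_gt0 ltnW.
have v0 : v != 0 by apply: contraNneq u0 => v0; rewrite [u]Eu v0 mul0r.
have w0 : w != 0 by apply: contraNneq u0 => w0; rewrite [u]Eu w0 mulr0.
have Et : u = tmul charK a v w by rewrite [u]Eu skew_mul_tmul.
have szE : size u = (size (v : {poly K}) + size (w : {poly K})).-1.
  by rewrite Et size_tmul.
by have [|] := irr v w Et v0 w0 szE; [left|right]; apply: invertible_size1.
Qed.

Variables (V : vectType K) (phi : V -> V).
Hypothesis phiP : semilinear_map charK a phi.
Hypothesis simple_phi : phi_simple phi.

Lemma semichar_irreducible (B : (\dim {: V}).-tuple V) y : basis_of fullv B ->
  y <> 0 \/ \dim {: V} = 1%N -> irreducible_elt (semichar charK a phi B y).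
Proof.
move=> bB y0_d1; have [d_gt0 _] := simple_phi.
apply: irreducible_skew; rewrite size_semichar // => v w Evw v0 w0 szE.
have sv := v0; have sw := w0; move: sv sw; rewrite -!size_poly_gt0 => sv sw.
case: y0_d1 => [/eqP y0|d1]; last by lia.
have chi0 : act phi (tmul charK a v w) y = 0.
  by rewrite -Evw; apply: (act_semichar a_gt0 phiP _ bB); rewrite ?memvf // => x _; apply: memvf.
rewrite (act_tmul phiP) in chi0.
have [w1|w1] := eqVneq (size w) 1%N; first by right.
have [v1|v1] := eqVneq (size v) 1%N; first by left.
have y'0 : act phi w y != 0 by apply: (act_simple_neq0 phiP) => //; lia.
have : act phi v (act phi w y) != 0 by apply: (act_simple_neq0 phiP) => //; lia.
by rewrite chi0 eqxx.
Qed.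

End Irreducibility.

(** * Passing to a subquotient *)

Section Subquotient.
Variables (K : fieldType) (p : nat) (charK : p \in [pchar K]) (a : nat).
Hypothesis a_gt0 : (0 < a)%N.
Variables (V : vectType K) (phi : {linear V -> V | frobq charK a \; *:%R}).
Local Notation q := (p ^ a)%N.
Variables (U W : {vspace V}).
Hypotheses (WU : (W <= U)%VS) (U_stable : phi_stable phi U) (W_stable : phi_stable phi W).
Local Notation E := (subquot U W).
Local Notation phiE := (subquot_map phi U W).

Lemma phi_semilinear : semilinear_map charK a phi.
Proof. by move=> c u v; rewrite linearP. Qed.

(** Extended to all of [V] through [vsproj] so as to be a linear map on [V]; it is meaningful on
    [U]. *)
Definition subquot_pr (v : V) : E := subquot_proj W (vsproj U v).
Definition subquot_lift (e : E) : V := vsval (repr (e : vquot _)).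

Lemma subquot_pr_linear : linear subquot_pr.
Proof. by move=> c u v; rewrite /subquot_pr /subquot_proj !linearP. Qed.

HB.instance Definition _ := GRing.isLinear.Build K V E _ subquot_pr subquot_pr_linear.

Lemma subquot_liftK : cancel subquot_lift subquot_pr.
Proof. by move=> e; rewrite /subquot_pr /subquot_lift vsvalK; apply: vqreprK. Qed.

Lemma mem_subquot_lift e : subquot_lift e \in U.
Proof. exact: subvsP. Qed.

Lemma subquot_pr_eq0 v : v \in U -> (subquot_pr v == 0) = (v \in W).
Proof.
move=> Uv; rewrite -(linear0 subquot_pr) /subquot_pr eq_vqproj.
by rewrite linear0 subr0 -memv_preim lfunE /= vsprojK.
Qed.

Lemma subquot_pr_phi v : v \in U -> phiE (subquot_pr v) = subquot_pr (phi v).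
Proof.
by move=> Uv; apply: subquot_mapE => //; rewrite !vsprojK // U_stable.
Qed.

Lemma subquot_map_semilinear : semilinear_map charK a phiE.
Proof.
move=> c e f; rewrite -(subquot_liftK e) -(subquot_liftK f) -linearP.
have Ue := mem_subquot_lift e; have Uf := mem_subquot_lift f.
rewrite !subquot_pr_phi ?rpredD ?rpredZ // phi_semilinear.
by rewrite linearP.
Qed.

Variables (d2 d1 : nat) (B : d2.-tuple E) (Y : d1.-tuple V).
Hypotheses (basisB : basis_of fullv B) (basisY : basis_of W Y).

(** The lifts come first, so [W] occupies the last coordinates, as [gsemichar_block] requires. *)
Definition lift_basis : (d2 + d1).-tuple V :=
  [tuple of map_tuple subquot_lift B ++ Y].

Lemma lift_basisl i : tnth lift_basis (lshift d1 i) = subquot_lift (tnth B i).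
Proof. by rewrite tnth_lshift tnth_map. Qed.

Lemma lift_basisr i : tnth lift_basis (rshift d2 i) = tnth Y i.
Proof. by rewrite tnth_rshift. Qed.

Lemma mem_basisY i : tnth Y i \in W.
Proof. by apply: (basis_mem basisY); rewrite mem_tnth. Qed.

Lemma lift_basisE v : v \in U -> exists2 w, w \in W &
  v = \sum_i coord B i (subquot_pr v) *: subquot_lift (tnth B i) + w.
Proof.
move=> Uv; set s := \sum_i _; exists (v - s); last by rewrite addrC subrK.
have Us : s \in U by apply: rpred_sum => i _; rewrite rpredZ ?mem_subquot_lift.
rewrite -subquot_pr_eq0 ?rpredB // linearB subr_eq0 linear_sum /=; apply/eqP.
rewrite [LHS](coord_basis basisB) ?memvf //; apply: eq_bigr => i _.
by rewrite linearZ /= subquot_liftK (tnth_nth 0).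
Qed.

Lemma lift_basis_basis : basis_of U lift_basis.
Proof.
apply/andP; split.
  rewrite eqEsubv; apply/andP; split.
    apply/span_subvP => x /tnthP[i ->]; rewrite -[i]splitK.
    case: (split i) => j /=; first by rewrite lift_basisl mem_subquot_lift.
    by rewrite lift_basisr (subvP WU) ?mem_basisY.
  apply/subvP => v /lift_basisE[w Ww ->]; rewrite rpredD //.
    apply: rpred_sum => i _; rewrite rpredZ // -lift_basisl memv_span //.
    by rewrite mem_tnth.
  rewrite (coord_basis basisY Ww); apply: rpred_sum => i _.
  by rewrite rpredZ // -tnth_nth -lift_basisr memv_span // mem_tnth.
have /freeP freeB := basis_free basisB; have /freeP freeY := basis_free basisY.
apply/freeP => k /= sumk; have k0 : \sum_i k i *: tnth lift_basis i = 0.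
  by rewrite -[RHS]sumk; apply: eq_bigr => i _; rewrite (tnth_nth 0).
(* Projecting to the quotient removes the part along [Y], and freeness of [B] applies. *)
have k0l i : k (lshift d1 i) = 0.
  apply: (freeB (fun i => k (lshift d1 i))).
  have := congr1 subquot_pr k0; rewrite linear0 linear_sum big_split_ord /=.
  rewrite [X in _ + X]big1 ?addr0 => [sum0|j _].
    rewrite -[RHS]sum0; apply: eq_bigr => j _.
    by rewrite -tnth_nth linearZ /= lift_basisl subquot_liftK.
  rewrite linearZ /= lift_basisr; have /eqP -> : subquot_pr (tnth Y j) == 0.
    by rewrite subquot_pr_eq0 ?mem_basisY // (subvP WU) ?mem_basisY.
  by rewrite scaler0.
move=> i; rewrite -[i]splitK; case: (split i) => j //=.
apply: (freeY (fun i => k (rshift d2 i))).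
move: k0; rewrite big_split_ord /= big1 ?add0r => [sum0|j' _].
  by rewrite -[RHS]sum0; apply: eq_bigr => j' _; rewrite -tnth_nth lift_basisr.
by rewrite k0l scale0r.
Qed.

Local Notation Z := lift_basis.

Lemma coord_lift_basis v : v \in U -> exists2 w, w \in W &
  v = \sum_i coord B i (subquot_pr v) *: subquot_lift (tnth B i) + w /\
  coord_vec Z v = col_mx (coord_vec B (subquot_pr v)) (coord_vec Y w).
Proof.
move=> /lift_basisE[w Ww Ev]; exists w; [done | split; first done].
apply/colP => i; rewrite -[i]splitK.
pose k i' := col_mx (coord_vec B (subquot_pr v)) (coord_vec Y w) i' 0.
rewrite -/(k _) mxE.
have -> : v = \sum_i' k i' *: Z`_i'.
  under eq_bigr do rewrite -tnth_nth.
  rewrite {1}Ev big_split_ord; congr (_ + _).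
    by apply: eq_bigr => j _; rewrite /k col_mxEu lift_basisl mxE.
  rewrite {1}(coord_basis basisY Ww); apply: eq_bigr => j _.
  by rewrite /k col_mxEd -tnth_nth lift_basisr mxE.
by rewrite coord_sum_free // (basis_free lift_basis_basis).
Qed.

Lemma usubmx_lift_basis v : v \in U -> usubmx (coord_vec Z v) = coord_vec B (subquot_pr v).
Proof. by move=> /coord_lift_basis[w _ [_ ->]]; rewrite col_mxKu. Qed.

Lemma dsubmx_lift_basis w : w \in W -> dsubmx (coord_vec Z w) = coord_vec Y w.
Proof.
move=> Ww; have Uw := subvP WU _ Ww.
have [w' _ [Ew ->]] := coord_lift_basis Uw; rewrite col_mxKd.
suff <- : w = w' by [].
rewrite Ew big1 ?add0r // => i _.
have /eqP -> : subquot_pr w == 0 by rewrite subquot_pr_eq0.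
by rewrite linear0 scale0r.
Qed.

Lemma lift_basis_mx : [/\ ursubmx (phi_mx phi Z) = 0,
  ulsubmx (phi_mx phi Z) = phi_mx phiE B & drsubmx (phi_mx phi Z) = phi_mx phi Y].
Proof.
have ZE i k : phi_mx phi Z i k = coord_vec Z (phi (tnth Z k)) i 0 by rewrite !mxE.
have UY j : tnth Y j \in U by rewrite (subvP WU) ?mem_basisY.
have uE i v : v \in U -> coord_vec Z v (lshift d1 i) 0 = coord B i (subquot_pr v).
  by move=> /usubmx_lift_basis/colP/(_ i); rewrite !mxE.
have dE i w : w \in W -> coord_vec Z w (rshift d2 i) 0 = coord Y i w.
  by move=> /dsubmx_lift_basis/colP/(_ i); rewrite !mxE.
split; apply/matrixP => i j.
- transitivity (phi_mx phi Z (lshift d1 i) (rshift d2 j)); first by rewrite !mxE.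
  rewrite ZE lift_basisr uE ?U_stable // mxE.
  have /eqP -> : subquot_pr (phi (tnth Y j)) == 0.
    by rewrite subquot_pr_eq0 ?U_stable // W_stable ?mem_basisY.
  by rewrite linear0.
- transitivity (phi_mx phi Z (lshift d1 i) (lshift d1 j)); first by rewrite !mxE.
  rewrite ZE lift_basisl uE ?U_stable ?mem_subquot_lift // mxE.
  by rewrite -subquot_pr_phi ?mem_subquot_lift // subquot_liftK.
- transitivity (phi_mx phi Z (rshift d2 i) (rshift d2 j)); first by rewrite !mxE.
  by rewrite ZE lift_basisr dE ?W_stable ?mem_basisY // mxE.
Qed.

Variables (d : nat) (X : d.-tuple V).
Hypothesis basisX : basis_of U X.

Definition residue v := act phi (semichar charK a phiE B (subquot_pr v)) v.

Lemma residueP v : v \in U -> [/\ residue v \in W &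
  semichar charK a phi X v =
  semichar charK a phi Y (residue v) * semichar charK a phiE B (subquot_pr v)].
Proof.
move=> Uv; have [G0 Gu Gd] := lift_basis_mx; have phiP := phi_semilinear.
have Uw : residue v \in U by apply: stable_act.
have coordw : coord_vec Z (residue v) = act (sfrob q (phi_mx phi Z))
    (semichar charK a phiE B (subquot_pr v)) (coord_vec Z v).
  exact: coord_vec_act lift_basis_basis Uv.
(* The upper coordinates of the residue are those of $\chi_{v \bmod W}$ applied to $v \bmod W$,
   hence zero. *)
have Ww : residue v \in W.
  rewrite -subquot_pr_eq0 //; apply/eqP; apply: (coord_vec_inj basisB); rewrite ?memvf //.
  rewrite -usubmx_lift_basis // coordw usubmx_act // usubmx_lift_basis // Gu.
  rewrite semicharE (act_gsemichar charK a_gt0).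
  by apply/colP => i; rewrite !mxE linear0.
split=> //.
rewrite (semichar_basis a_gt0 phiP U_stable basisX lift_basis_basis Uv).
rewrite [RHS]skew_mul_tmul [LHS]semicharE (gsemichar_block charK a_gt0) //.
rewrite !semicharE Gu Gd usubmx_lift_basis //; congr (tmul _ _ (cpoly _) _).
by rewrite -semicharE -coordw dsubmx_lift_basis.
Qed.

(** [phi_generator] relative to a submodule, so that generation can be followed down the
    filtration. *)
Definition generates (T : {vspace V}) v := forall T' : {vspace V},
  (T' <= T)%VS -> phi_stable phi T' -> v \in T' -> T' = T.

(** A dimension count: if a stable [S] inside [W] contains the residue, then [S] and the first [d2]
    iterates of [v] span a stable space containing [v], which is [U]. So [S] has dimension at least
    [d1], that of [W]. *)
Lemma generates_residue v : v \in U -> generates U v -> generates W (residue v).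
Proof.
move=> Uv genv S SW Ss Sw; have phiP := phi_semilinear.
have [||st vS] := @krylov_space_stable _ _ charK a V phi phiP S v d2 => //.
  have := Sw; rewrite /residue semicharE act_cpoly => Sw'.
  rewrite -[iter d2 _ _](subrK (\sum_(i < d2) gsemichar p a idfun
    (phi_mx phiE B) (coord_vec B (subquot_pr v)) i 0 *: iter i phi v)).
  apply: rpredD; first exact: (subvP (krylov_spaceS _ _ _ _)) _ Sw'.
  by apply: rpred_sum => i _; rewrite rpredZ // mem_krylov_space.
have EU : krylov_space phi S v d2 = U.
  apply: genv => //; rewrite subv_add (subv_trans SW WU); apply/span_subvP => x.
  by case/mapP => i _ ->; apply: stable_iter.
apply/eqP; rewrite eqEdim SW (vector.size_basis basisY).
have := dim_krylov_space phi S v d2; rewrite EU (vector.size_basis lift_basis_basis).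
by rewrite addnC leq_add2r.
Qed.

(** If [v] were in [W], then [W] would equal [U] and the quotient would have dimension 0. *)
Lemma generates_pr_neq0 v : v \in U -> generates U v -> (0 < d2)%N ->
  subquot_pr v <> 0.
Proof.
move=> Uv genv d2_gt0 /eqP; rewrite subquot_pr_eq0 // => Wv.
have := vector.size_basis lift_basis_basis.
rewrite -(genv W WU W_stable Wv) (vector.size_basis basisY) -[LHS]add0n.
by move/addIn => d2_0; rewrite -d2_0 in d2_gt0.
Qed.

End Subquotient.

(** * Descent along the Jordan-Hölder sequence *)

Lemma prod_rev_ord (R : nzRingType) (f : nat -> R) k :
  \prod_(i < k.+1) f (rev_ord i) = f k * \prod_(i < k) f (rev_ord i).
Proof. by rewrite big_ord_recl /= subn1. Qed.

Theorem theorem1p4p4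
  (K : fieldType) (p a : nat) (charK : p \in [pchar K]) (a_gt0 : (0 < a)%N)
  (Fq : finFieldType) (card_Fq : #|Fq| = (p ^ a)%N) (Fq_in_K : {rmorphism Fq -> K})
  (D : vectType K) (phi : {linear D -> D | frobq charK a \; *:%R})
  (m : nat) (D_ : nat -> {vspace D}) (JH : jordan_holder phi m D_)
  (B : (\dim {: D}).-tuple D) (basisB : basis_of fullv B)
  (B_ : forall i : 'I_m,
     (\dim {: subquot (D_ i) (D_ i.+1)}).-tuple (subquot (D_ i) (D_ i.+1)))
  (basisB_ : forall i : 'I_m, basis_of fullv (B_ i))
  (x : D) :
  exists y : forall i : 'I_m, subquot (D_ i) (D_ i.+1),
    let pi_ (i : 'I_m) := semichar charK a (subquot_map phi (D_ i) (D_ i.+1)) (B_ i) (y i) in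
    semichar charK a phi B x = \prod_(i < m) pi_ (rev_ord i) /\
    (forall i : 'I_m,
       [\/ y i <> 0, \dim {: subquot (D_ i) (D_ i.+1)} = 1%N | phi_generator phi x] ->
       irreducible_elt (pi_ i)).
Proof.
have [D0 Dm Dst Dsub Dsimple] := JH.
(* The recursion [xs] runs over all natural numbers while [B_] is indexed by ordinals; canonical
   bases serve in the recursion, and [fE] restores [B_]. *)
pose bE i := vbasis (fullv : {vspace subquot (D_ i) (D_ i.+1)}).
have bEP i : basis_of fullv (bE i) by apply: vbasisP.
pose xs := fix xs i := if i is j.+1 then
  residue phi (bE j) (xs j) else x.
pose f i := semichar charK a (subquot_map phi (D_ i) (D_ i.+1)) (bE i)
  (subquot_pr (D_ i) (D_ i.+1) (xs i)).
pose chi i := semichar charK a phi (vbasis (D_ i)) (xs i).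
have Dst' i : (i < m)%N -> phi_stable phi (D_ i) by move=> ltim; apply/Dst/ltnW.
have step i : (i < m)%N -> xs i \in D_ i -> xs i.+1 \in D_ i.+1 /\ chi i = chi i.+1 * f i.
  move=> ltim xsi; exact: (residueP a_gt0 (Dsub i ltim) (Dst' i ltim)
    (Dst i.+1 ltim) (bEP i) (vbasisP (D_ i.+1)) (vbasisP (D_ i)) xsi).
have xsD i : (i <= m)%N -> xs i \in D_ i.
  elim: i => [|i IHi] lim; first by rewrite D0 memvf.
  by have [] := step i lim (IHi (ltnW lim)).
(* Each step splits off a right factor of [chi k], so the factor of highest index ends up
   leftmost. *)
have chiE k : (k <= m)%N -> chi 0%N = chi k * \prod_(i < k) f (rev_ord i).
  elim: k => [|k IHk] lkm; first by rewrite big_ord0 mulr1.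
  have [_ chik] := step k lkm (xsD k (ltnW lkm)).
  by rewrite (IHk (ltnW lkm)) chik prod_rev_ord mulrA.
have phiP := phi_semilinear phi.
have phiEP (i : 'I_m) : semilinear_map charK a (subquot_map phi (D_ i) (D_ i.+1)).
  apply: subquot_map_semilinear; [exact: Dst' | exact: Dst].
have fE (i : 'I_m) : f i = semichar charK a (subquot_map phi (D_ i) (D_ i.+1)) (B_ i)
    (subquot_pr (D_ i) (D_ i.+1) (xs i)).
  apply: (semichar_basis a_gt0 (phiEP i) _ (bEP i) (basisB_ i));
    by rewrite ?memvf // => v _; apply: memvf.
exists (fun i : 'I_m => subquot_pr (D_ i) (D_ i.+1) (xs i)) => pi_; split.
  have -> : semichar charK a phi B x = chi 0%N.
    apply: (semichar_basis a_gt0 phiP _ basisB).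
    - by move=> v _; apply: memvf.
    - by rewrite -D0; apply: vbasisP.
    - exact: memvf.
  (* On [D_ m], which is zero, the basis is empty and the polynomial is $X^0 = 1$. *)
  rewrite (chiE m) // (_ : chi m = 1) ?mul1r; last first.
    rewrite /chi; move: (vbasis _) (xs m); rewrite Dm dimv0 => X v.
    by rewrite /semichar big_ord0 subr0.
  by apply: eq_bigr => i _; rewrite /pi_ -fE.
move=> i yi; apply: (semichar_irreducible a_gt0 (phiEP i)) => //; first exact: Dsimple.
case: yi => [yi|d1|genx]; [by left | by right | left].
(* A generator [x] yields a generator [xs k] of each [D_ k], hence a nonzero class in every nonzero
   quotient. *)
have gen k : (k <= m)%N -> generates phi (D_ k) (xs k).
  elim: k => [|k IHk] lkm.
    by rewrite D0 => T _ Ts Tx; apply: genx.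
  apply: (generates_residue (Dsub k lkm) (Dst' k lkm) (bEP k) (vbasisP _)).
  - exact: xsD (ltnW lkm).
  - exact: IHk (ltnW lkm).
have [d_gt0 _] := Dsimple i (ltn_ord i).
apply: (generates_pr_neq0 (Dsub i (ltn_ord i)) (Dst i.+1 (ltn_ord i)) (bEP i)
  (vbasisP _)) d_gt0.
- exact/xsD/ltnW.
- exact/gen/ltnW.
Qed.
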